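(* For any $q>1$ and any $p\in(0,1)$, the mixing time $\tau_{\rm mix}^{\rm GD}$ of the Glauber dynamics for the random-cluster model with parameters $p,q$ on a graph $G$ with $n$ vertices and $m$ edges satisfies $$\tau_{\rm mix}^{\rm GD}\le O\left(mn\log n+p\,m^2\log n\cdot\log\frac{1}{\min\{p,1-p\}}\right)\cdot\tau_{\rm mix}^{\rm CM},$$ where $\tau_{\rm mix}^{\rm CM}$ is the mixing time of the Chayes–Machta dynamics on the same graph with the same parameters.
   Context: Graphs are finite and simple. The random-cluster model on $G=(V,E)$ with parameters $p\in(0,1)$, $q>0$ is the probability measure on subsets $A\subseteq E$ given by $\mu_{G,p,q}(A)=\frac1Z p^{|A|}(1-p)^{|E|-|A|}q^{c(A)}$, where $c(A)$ is the number of connected components of $(V,A)$ and $Z$ is the normalizing constant. One step of the Chayes–Machta (CM) dynamics ($q>1$) from a configuration $A$: (i) activate each connected component of $(V,A)$ independently with probability $1/q$; (ii) remove all edges of $A$ joining two active vertices (vertices of activated components); (iii) add each edge of $G$ between two active vertices independently with probability $p$, leaving the rest unchanged. One step of the (heat-bath) Glauber dynamics from $A$: (i) pick $e\in E$ uniformly at random; (ii) move to $A\cup\{e\}$ with probability $\frac{\mu_{G,p,q}(A\cup\{e\})}{\mu_{G,p,q}(A\cup\{e\})+\mu_{G,p,q}(A\setminus\{e\})}$; (iii) otherwise move to $A\setminus\{e\}$. The mixing time of a Markov chain with transition matrix $M$ and stationary distribution $\mu$ is $\max_{X_0}\min\{t\ge0:\|M^t(X_0,\cdot)-\mu\|_{TV}\le1/4\}$.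 The implied constant depends only on $q$. *)

(* Defs.v *)
From HB Require Import structures.
From mathcomp Require Import all_boot all_order all_algebra.
From mathcomp Require Import all_classical all_reals all_analysis.

Set Implicit Arguments.
Unset Strict Implicit.
Unset Printing Implicit Defensive.

Import Order.TTheory GRing.Theory Num.Theory.

Local Open Scope ring_scope.

Section Markov.
Context {R : realType} {S : finType}.
Implicit Types (M : S -> S -> R) (mu nu : S -> R).

Fixpoint kpow M (t : nat) (x y : S) : R :=
  if t is t'.+1 then \sum_(z : S) M x z * kpow M t' z y else (x == y)%:R.

Definition tv_dist mu nu : R := 2%:R^-1 * \sum_(x : S) `|mu x - nu x|.

(* The infimum of a nonempty set of natural numbers is its minimum; a chain
   that never gets 1/4-close to mu from x has mixing time +oo. *)
Definition mixing_time_from M mu (x : S) : \bar R :=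
  ereal_inf [set (t%:R)%:E | t in [set t : nat |
    tv_dist (kpow M t x) mu <= 4%:R^-1]]%classic.

(* The default 0 of the maximum is harmless: mixing times are nonnegative. *)
Definition mixing_time M mu : \bar R :=
  \big[maxe/0%E]_(x : S) mixing_time_from M mu x.

End Markov.

Section RandomCluster.
Context {R : realType} {V : finType}.
(* The simple graph with vertex set V and adjacency relation adj, assumed
   symmetric and irreflexive in the theorem. *)
Variable adj : rel V.

Definition edge_set : {set {set V}} :=
  [set [set uv.1; uv.2] | uv : V * V & adj uv.1 uv.2].

Definition edge : finType := {f : {set V} | f \in edge_set}.

Definition config : finType := {set edge}.

Implicit Types (A B : config) (p q : R).

Definition config_adj A : rel V :=
  fun u v => [exists f in A, val f == [set u; v]].

Definition components A : {set {set V}} :=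
  equivalence_partition (connect (config_adj A)) [set: V].

Definition rc_weight p q A : R :=
  p ^+ #|A| * (1 - p) ^+ (#|edge| - #|A|) * q ^+ #|components A|.

Definition rc_measure p q A : R :=
  rc_weight p q A / \sum_(B : config) rc_weight p q B.

Definition edges_within (U : {set V}) : {set edge} :=
  [set f : edge | val f \subset U].

(* The probability that a random subset of a set of size n, containing each
   element independently with probability a, equals a given subset of size k. *)
Definition indep_prob (a : R) (n k : nat) : R := a ^+ k * (1 - a) ^+ (n - k).

(* W is the set of activated components, and D the set of edges opened among
   the active vertices, which are those in finset.cover W. *)
Definition cm_step p q A B : R :=
  \sum_(W in powerset (components A))
    indep_prob q^-1 #|components A| #|W| *
    \sum_(D in powerset (edges_within (finset.cover W)))
      indep_prob p #|edges_within (finset.cover W)| #|D| *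
      (B == (A :\: edges_within (finset.cover W)) :|: D)%:R.

Definition glauber_open_prob p q A (f : edge) : R :=
  rc_measure p q (f |: A) / (rc_measure p q (f |: A) + rc_measure p q (A :\ f)).

(* When the graph has no edge this is the zero kernel on the one-point state
   space; only its power 0 then matters, and the mixing time is 0. *)
Definition glauber_step p q A B : R :=
  (#|edge|%:R)^-1 * \sum_(f : edge)
    (glauber_open_prob p q A f * (B == f |: A)%:R +
     (1 - glauber_open_prob p q A f) * (B == A :\ f)%:R).

End RandomCluster.

Arguments rc_measure {R V} adj p q A.
Arguments cm_step {R V} adj p q A B.
Arguments glauber_step {R V} adj p q A B.

(* Main.v *)
(* The comparison goes through Dirichlet forms. Given the set [U] of active
   vertices and the edges not inside [U], the Chayes-Machta step resamples the
   edges inside [U] from a product Bernoulli measure, because the activation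
   probability [1/q] cancels the weight [q] of an activated component. Hence its
   Dirichlet form is the mean of the variances of these products, which
   Efron-Stein bounds by [p * (1 - p)] times the sum over all edges of the mean
   squared discrete derivatives, and that is at most [q * m] times the Dirichlet
   form of the Glauber dynamics. Mixing of the Chayes-Machta dynamics at time [T]
   gives it a spectral gap of at least [1 / (2 * T)], so the Glauber dynamics has
   one of at least [1 / (2 * q * m * T)].
   From a start [A] the Glauber dynamics then needs time about
   [2 * q * m * T * ln (1 / mu A)]. The factor [p] in front of [m ^+ 2] comes
   from a burn-in of about [m * ln m] steps: each update opens its edge with
   probability at most [p], so after the burn-in [O(p * m)] edges are open with
   high probability, and [mu A] is not too small for such an [A]. *)
Require Import Defs.
From HB Require Import structures.
From mathcomp Require Import all_boot all_order all_algebra.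
From mathcomp Require Import all_classical all_reals all_analysis.
From mathcomp Require Import ring lra.

Set Implicit Arguments.
Unset Strict Implicit.
Unset Printing Implicit Defensive.

Import Order.TTheory GRing.Theory Num.Theory.

Local Open Scope ring_scope.

(** * Reversible Markov chains *)

Section RealInequalities.
Context {R : realType}.
Implicit Types (x y : R).

Lemma bernoulli_inequality x n : 0 <= x -> 1 + n%:R * (x - 1) <= x ^+ n.
Proof.
move=> x0; elim: n => [|n IHn]; first by rewrite expr0 mul0r addr0.
rewrite exprS; apply: (le_trans _ (ler_wpM2l x0 IHn)).
rewrite -subr_ge0.
have -> : x * (1 + n%:R * (x - 1)) - (1 + n.+1%:R * (x - 1)) =
  n%:R * (x - 1) ^+ 2 by rewrite -natr1; ring.
by rewrite mulr_ge0 // sqr_ge0.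
Qed.

Lemma bounded_powers_le1 x y : 0 <= x -> (forall n, x ^+ n <= y) -> x <= 1.
Proof.
move=> x0 xy; rewrite leNgt; apply/negP => x1.
have x10 : 0 < x - 1 by rewrite subr_gt0.
have := truncnS_gt (y / (x - 1)); rewrite ltr_pdivrMr // => yn.
have := le_trans (bernoulli_inequality (Num.truncn (y / (x - 1))).+1 x0) (xy _).
lra.
Qed.

Lemma ler_norm_sqr x y : `|x| <= y -> x ^+ 2 <= y ^+ 2.
Proof.
move=> xy; rewrite -(real_normK (num_real x)) lerXn2r ?nnegrE //.
exact: le_trans xy.
Qed.

(** Source of both Cauchy-Schwarz inequalities below. The quadratic is evaluated at its minimum
    [- z / x]; for [x = 0] a linear function bounded below must have zero slope. *)
Lemma discriminant_le0 x y z :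
  (forall t, 0 <= x * t ^+ 2 + 2 * z * t + y) -> 0 <= x -> z ^+ 2 <= x * y.
Proof.
move=> H; rewrite le_eqVlt => /predU1P[x0|x0].
  have [-> |z0] := eqVneq z 0; first by rewrite -x0 expr0n mul0r.
  have := H (- (y + 1) / (2 * z)); rewrite -x0 mul0r add0r.
  have -> : 2 * z * (- (y + 1) / (2 * z)) = - (y + 1) by field.
  lra.
have := H (- z / x); rewrite -(pmulr_rge0 _ x0).
have -> : x * (x * (- z / x) ^+ 2 + 2 * z * (- z / x) + y) = x * y - z ^+ 2.
  by field; rewrite gt_eqF.
by rewrite subr_ge0.
Qed.

(** Successive ratios of a log-convex sequence are nondecreasing, hence at least the first one. *)
Lemma log_convex_lower_bound (b : nat -> R) :
  (forall j, 0 <= b j) -> (forall j, b j.+1 ^+ 2 <= b j * b j.+2) ->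
  0 < b 0%N -> forall j, (b 1%N / b 0%N) ^+ j * b 0%N <= b j.
Proof.
move=> b0 lc b00; set s := b 1%N / b 0%N.
have s0 : 0 <= s by rewrite divr_ge0.
have step j : s * b j <= b j.+1.
  elim: j => [|j IHj]; first by rewrite /s divfK ?gt_eqF.
  (* If [b j.+1] vanishes the claim is trivial; otherwise log-convexity forces [b j] to be positive,
     so it can be cancelled. *)
  have := b0 j.+1; rewrite le_eqVlt => /predU1P[<-|b1]; first by rewrite mulr0.
  have bj : 0 < b j.
    rewrite lt_neqAle b0 andbT eq_sym; apply/eqP => bj.
    by have := lc j; rewrite bj mul0r leNgt exprn_gt0.
  rewrite -(ler_pM2l bj) (le_trans _ (lc j)) // mulrCA expr2 mulrA.
  by rewrite ler_wpM2r // ltW.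
elim=> [|j IHj]; first by rewrite expr0 mul1r.
by rewrite exprS -mulrA (le_trans _ (step j)) // ler_wpM2l.
Qed.

Lemma sqr_sum_le_card (I : finType) (F : I -> R) :
  (\sum_i F i) ^+ 2 <= #|I|%:R * \sum_i F i ^+ 2.
Proof.
apply: discriminant_le0 => [t|]; last by rewrite ler0n.
have -> : #|I|%:R * t ^+ 2 + 2 * (\sum_i F i) * t + \sum_i F i ^+ 2 =
  \sum_i (t + F i) ^+ 2.
  have sq i : (t + F i) ^+ 2 = t ^+ 2 + (2 * t) * F i + F i ^+ 2 by ring.
  under [RHS]eq_bigr do rewrite sq.
  by rewrite !big_split /= sumr_const -mulr_sumr -mulr_natl; ring.
by apply: sumr_ge0 => i _; apply: sqr_ge0.
Qed.

End RealInequalities.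

(** * Reversible kernels as self-adjoint operators, and mixing versus spectral gap *)

Section Reversible.
Context {R : realType} {S : finType}.
Variable mu : S -> R.
Implicit Types (f g : S -> R) (M : S -> S -> R).

(** The inner product of $L^2$ for the weight [mu]. It is also used for the weights [joint U], whose
    masses add up to 1 over [U]. *)
Definition dot f g : R := \sum_x mu x * (f x * g x).

Definition kop M f (x : S) : R := \sum_y M x y * f y.

Definition indic (a x : S) : R := (x == a)%:R.

(** Reversibility in operator form: on two indicators it reads as detailed balance. *)
Definition self_adjoint M := forall f g, dot f (kop M g) = dot (kop M f) g.

Definition stochastic M :=
  (forall x y, 0 <= M x y) /\ (forall x, \sum_y M x y = 1).

Lemma dotC f g : dot f g = dot g f.
Proof. by apply: eq_bigr => x _; rewrite (mulrC (f x)). Qed.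

Lemma sum_indic (F : S -> R) a : \sum_x F x * (x == a)%:R = F a.
Proof.
rewrite (bigD1 a) //= eqxx mulr1 big1 ?addr0 // => x /negPf ->.
by rewrite mulr0.
Qed.

Lemma dot_indic a f : dot (indic a) f = mu a * f a.
Proof.
rewrite /dot -(sum_indic (fun x => mu x * f x)); apply: eq_bigr => x _.
by rewrite /indic; ring.
Qed.

Lemma kop_indic M a x : kop M (indic a) x = M x a.
Proof. exact: sum_indic. Qed.

Lemma kop_sub_cst M f c x : stochastic M ->
  kop M (fun y => f y - c) x = kop M f x - c.
Proof.
case=> _ M1; rewrite /kop; under eq_bigr do rewrite mulrBr.
by rewrite sumrB -mulr_suml M1 mul1r.
Qed.

Lemma iter_kop_sub_cst M f c t : stochastic M ->
  iter t (kop M) (fun y => f y - c) = fun x => iter t (kop M) f x - c.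
Proof.
move=> HM; elim: t => //= t ->.
by apply/funext => x; rewrite kop_sub_cst.
Qed.

Lemma kpow_kop M t x f : \sum_y kpow M t x y * f y = iter t (kop M) f x.
Proof.
elim: t x => [|t IHt] x /=.
  rewrite -[RHS](sum_indic f); apply: eq_bigr => y _.
  by rewrite mulrC eq_sym.
under eq_bigr do rewrite mulr_suml.
rewrite exchange_big; apply: eq_bigr => z _.
by rewrite -IHt mulr_sumr; apply: eq_bigr => y _; rewrite mulrA.
Qed.

Lemma kpow_iter M t x y : kpow M t x y = iter t (kop M) (indic y) x.
Proof. by rewrite -kpow_kop sum_indic. Qed.

Lemma kpowD M s t x y :
  kpow M (s + t) x y = \sum_z kpow M s x z * kpow M t z y.
Proof.
rewrite kpow_iter iterD -kpow_kop; apply: eq_bigr => z _.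
by rewrite -kpow_iter.
Qed.

Lemma kpow_stochastic M t : stochastic M -> stochastic (kpow M t).
Proof.
move=> HM; have [M0 M1] := HM; split=> [x y|x].
  elim: t x => [|t IHt] x /=; first exact: ler0n.
  by apply: sumr_ge0 => z _; exact: mulr_ge0.
elim: t x => [|t IHt] x /=.
  rewrite -[RHS](sum_indic (fun=> 1) x); apply: eq_bigr => y _.
  by rewrite mul1r eq_sym.
rewrite exchange_big /= -[RHS](M1 x); apply: eq_bigr => z _.
by rewrite -mulr_sumr IHt mulr1.
Qed.

Section Probability.
Hypothesis mu_gt0 : forall x, 0 < mu x.
Hypothesis mu_sum1 : \sum_x mu x = 1.

Lemma dot_ge0 f : 0 <= dot f f.
Proof.
apply: sumr_ge0 => x _; by rewrite -expr2 mulr_ge0 ?sqr_ge0 // ltW.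
Qed.

Lemma dot_Cauchy_Schwarz f g : dot f g ^+ 2 <= dot f f * dot g g.
Proof.
apply: discriminant_le0 => [t|]; last exact: dot_ge0.
have -> : dot f f * t ^+ 2 + 2 * dot f g * t + dot g g =
  dot (fun x => f x * t + g x) (fun x => f x * t + g x).
  rewrite /dot mulr_sumr !mulr_suml -!big_split /=; apply: eq_bigr => x _.
  by ring.
exact: dot_ge0.
Qed.

Lemma kop_stationary M y : stochastic M -> self_adjoint M ->
  \sum_x mu x * M x y = mu y.
Proof.
move=> [M0 M1] Msa; have := Msa (indic y) (fun=> 1).
rewrite dot_indic.
have -> : kop M (fun=> 1) y = 1.
  by rewrite -[RHS](M1 y); apply: eq_bigr => x _; rewrite mulr1.
rewrite mulr1 => ->; apply: eq_bigr => x _; by rewrite kop_indic mulr1.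
Qed.

Lemma dot1_kop M f : stochastic M -> self_adjoint M ->
  dot (kop M f) (fun=> 1) = dot f (fun=> 1).
Proof.
move=> [M0 M1] Msa; rewrite -Msa; apply: eq_bigr => x _.
congr (_ * (_ * _)); rewrite -[RHS](M1 x); apply: eq_bigr => y _.
by rewrite mulr1.
Qed.

Lemma dot1_iter_kop M f t : stochastic M -> self_adjoint M ->
  dot f (fun=> 1) = 0 -> dot (iter t (kop M) f) (fun=> 1) = 0.
Proof. by move=> HM Msa f0; elim: t => //= t IHt; rewrite dot1_kop. Qed.

Lemma self_adjoint_iter M t f g : self_adjoint M ->
  dot f (iter t (kop M) g) = dot (iter t (kop M) f) g.
Proof.
by move=> Msa; elim: t f g => //= t IHt f g; rewrite Msa IHt -iterSr.
Qed.

Lemma kpow_stationary M t y : stochastic M -> self_adjoint M ->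
  \sum_x mu x * kpow M t x y = mu y.
Proof.
move=> HM Msa; apply: kop_stationary; first exact: kpow_stochastic.
move=> f g; have E h : kop (kpow M t) h = iter t (kop M) h.
  by apply/funext => x; rewrite -kpow_kop.
by rewrite !E self_adjoint_iter.
Qed.

(** The last [t] steps fix [mu] and contract the $\ell^1$ norm. This brings the mixing times of all
    starts to one common time. *)
Lemma tv_dist_kpowD M s t x : stochastic M -> self_adjoint M ->
  tv_dist (kpow M (s + t) x) mu <= tv_dist (kpow M s x) mu.
Proof.
move=> HM Msa; rewrite ler_wpM2l ?invr_ge0 //.
have [K0 K1] := kpow_stochastic t HM.
apply: (@le_trans _ _ (\sum_y \sum_z `|kpow M s x z - mu z| * kpow M t z y)).
  apply: ler_sum => y _; rewrite kpowD -{1}(kpow_stationary t y HM Msa).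
  rewrite -sumrB (le_trans (ler_norm_sum _ _ _)) //; apply: ler_sum => z _.
  by rewrite -mulrBl normrM (ger0_norm (K0 _ _)).
rewrite exchange_big /=; apply: ler_sum => z _.
by rewrite -mulr_sumr K1 mulr1.
Qed.

(** Conditioning on the state after [s] steps; the burn-in argument averages over that state. *)
Lemma tv_dist_kpow_convex M s t x : stochastic M ->
  tv_dist (kpow M (s + t) x) mu <=
  \sum_z kpow M s x z * tv_dist (kpow M t z) mu.
Proof.
move=> HM; have [K0 K1] := kpow_stochastic s HM.
rewrite /tv_dist; under [leRHS]eq_bigr do rewrite mulrCA mulr_sumr.
rewrite -mulr_sumr ler_wpM2l ?invr_ge0 // exchange_big /=.
apply: ler_sum => y _; rewrite kpowD.
rewrite -[in leLHS](mul1r (mu y)) -(K1 x) mulr_suml -sumrB.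
rewrite (le_trans (ler_norm_sum _ _ _)) //; apply: ler_sum => z _.
by rewrite -mulrBr normrM (ger0_norm (K0 _ _)).
Qed.

Lemma tv_dist_le1 M t x : stochastic M -> tv_dist (kpow M t x) mu <= 1.
Proof.
move=> HM; have [K0 K1] := kpow_stochastic t HM.
rewrite /tv_dist.
suff : \sum_y `|kpow M t x y - mu y| <= 2 by lra.
have -> : 2 = \sum_y (kpow M t x y + mu y).
  by rewrite big_split /= K1 mu_sum1.
apply: ler_sum => y _; rewrite (le_trans (ler_normB _ _)) //.
by rewrite !ger0_norm // ltW.
Qed.

(** As [f] has mean zero, [mu] can be subtracted from the kernel, and the difference has $\ell^1$
    norm at most [2 * 4^-1]. *)
Lemma mixed_halves_sup M T f c : stochastic M -> self_adjoint M ->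
  (forall x, tv_dist (kpow M T x) mu <= 4^-1) ->
  dot f (fun=> 1) = 0 -> (forall x, `|f x| <= c) ->
  forall x, `|iter T (kop M) f x| <= c / 2.
Proof.
move=> HM Msa mix f0 fc x.
have c0 : 0 <= c := le_trans (normr_ge0 _) (fc x).
have -> : iter T (kop M) f x = \sum_y (kpow M T x y - mu y) * f y.
  under eq_bigr do rewrite mulrBl.
  rewrite sumrB kpow_kop -[LHS]subr0; congr (_ - _); rewrite -[LHS]f0.
  by apply: eq_bigr => y _; rewrite mulr1.
rewrite (le_trans (ler_norm_sum _ _ _)) //.
apply: (@le_trans _ _ (\sum_y `|kpow M T x y - mu y| * c)).
  by apply: ler_sum => y _; rewrite normrM ler_wpM2l.
rewrite -mulr_suml mulrC ler_wpM2l //.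
have := mix x; rewrite /tv_dist; lra.
Qed.

Lemma mixed_shrinks_sup M T f c : stochastic M -> self_adjoint M ->
  (forall x, tv_dist (kpow M T x) mu <= 4^-1) ->
  dot f (fun=> 1) = 0 -> (forall x, `|f x| <= c) ->
  forall k x, `|iter (k * T) (kop M) f x| <= c / 2 ^+ k.
Proof.
move=> HM Msa mix f0 fc; elim=> [|k IHk] x.
  by rewrite mul0n expr0 divr1.
rewrite mulSn iterD exprSr invfM mulrA.
apply: mixed_halves_sup => //; exact: dot1_iter_kop.
Qed.

(* Along the orbit of [f] the squared norms are log-convex, so their first
   ratio is at most the asymptotic decay rate, which mixing controls. *)
Lemma mixed_spectral_gap M T f : stochastic M -> self_adjoint M ->
  (0 < T)%N -> (forall x, tv_dist (kpow M T x) mu <= 4^-1) ->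
  dot f (fun=> 1) = 0 ->
  dot f f <= 2 * T%:R * (dot f f - dot f (kop M f)).
Proof.
move=> HM Msa T0 mix f0.
have T1 : 1 <= T%:R :> R by rewrite ler1n.
have := dot_ge0 f; rewrite le_eqVlt => /predU1P[a0|a0].
  have : dot f (kop M f) = 0.
    apply/eqP; rewrite -sqrf_eq0 eq_le sqr_ge0 andbT.
    by rewrite (le_trans (dot_Cauchy_Schwarz _ _)) // -a0 mul0r.
  by move=> ->; rewrite -a0 subrr mulr0.
pose b j := dot (iter j (kop M) f) (iter j (kop M) f).
have b_ge0 j : 0 <= b j by exact: dot_ge0.
have blc j : b j.+1 ^+ 2 <= b j * b j.+2.
  by rewrite {1}/b /= -Msa; exact: dot_Cauchy_Schwarz.
pose s := b 1%N / b 0%N; have s0 : 0 <= s by rewrite divr_ge0.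
have low j : s ^+ j * b 0%N <= b j by apply: log_convex_lower_bound.
pose c := \sum_x `|f x|.
have fc x : `|f x| <= c.
  by rewrite /c (bigD1 x) //= lerDl sumr_ge0.
have c0 : 0 <= c by exact: sumr_ge0.
have up k : b (k * T)%N <= (c / 2 ^+ k) ^+ 2.
  have -> : (c / 2 ^+ k) ^+ 2 = \sum_x mu x * (c / 2 ^+ k) ^+ 2.
    by rewrite -mulr_suml mu_sum1 mul1r.
  apply: ler_sum => x _; rewrite -expr2 (ler_wpM2l (ltW (mu_gt0 x))) //.
  exact/ler_norm_sqr/mixed_shrinks_sup.
(* Comparing [low] and [up] at the times [k * T] bounds the powers of [4 * s ^+ T] uniformly in
   [k]. *)
have s4 : 4 * s ^+ T <= 1.
  apply: (@bounded_powers_le1 _ _ (c ^+ 2 / b 0%N)).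
    by rewrite mulr_ge0 ?exprn_ge0.
  move=> k; rewrite ler_pdivlMr // exprMn -exprM mulnC -mulrA.
  have := le_trans (low (k * T)%N) (up k).
  have -> : (c / 2 ^+ k) ^+ 2 = c ^+ 2 / 4 ^+ k.
    have -> : 4 = 2 ^+ 2 :> R by ring.
    by rewrite expr_div_n -!exprM mulnC.
  by rewrite ler_pdivlMr ?exprn_gt0 // mulrC.
pose r := dot f (kop M f) / dot f f.
have ar : dot f (kop M f) = r * dot f f by rewrite /r divfK ?gt_eqF.
suff H : 1 <= 2 * T%:R * (1 - r).
  have -> : dot f f - dot f (kop M f) = (1 - r) * dot f f by rewrite {1}ar; ring.
  by rewrite mulrA ler_peMl ?dot_ge0.
(* For a nonpositive Rayleigh quotient [r] the gap is at least 1, and [T >= 1] suffices. *)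
have [r0|r0] := leP r 0.
  have : 2 * T%:R * r <= 0 by rewrite mulr_ge0_le0 // mulr_ge0.
  lra.
have rs : r ^+ 2 <= s.
  rewrite /r expr_div_n ler_pdivrMr ?exprn_gt0 //.
  have -> : s * dot f f ^+ 2 = dot f f * b 1%N.
    by rewrite /s /b /=; field; rewrite gt_eqF.
  exact: dot_Cauchy_Schwarz.
have rT : r ^+ T <= 2^-1.
  rewrite -(@ler_pXn2r _ 2) ?nnegrE ?exprn_ge0 ?invr_ge0 ?(ltW r0) //.
  rewrite -exprM mulnC exprM.
  have : (r ^+ 2) ^+ T <= s ^+ T.
    by rewrite lerXn2r ?nnegrE ?exprn_ge0 // ltW.
  lra.
(* Bernoulli turns [r ^+ T <= 2^-1] into [T%:R * (1 - r) >= 2^-1]. *)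
have := bernoulli_inequality T (ltW r0).
lra.
Qed.

(** The chi-square bound: by Cauchy-Schwarz the $\ell^1$ distance is at most the $L^2$ norm of the
    density minus 1, which contracts from the initial squared norm [(mu x)^-1 - 1]. *)
Lemma contraction_tv_dist M gamma t x : stochastic M -> self_adjoint M ->
  0 <= gamma -> 
  (forall f, dot f (fun=> 1) = 0 ->
    dot (kop M f) (kop M f) <= gamma * dot f f) ->
  (2 * tv_dist (kpow M t x) mu) ^+ 2 <= gamma ^+ t / mu x.
Proof.
move=> HM Msa g0 contr.
(* [h] is the density of the point mass at [x]; by reversibility its image under the operator power
   is the density of the law at time [t]. *)
pose h y := indic x y / mu x.
have kpowE y : kpow M t x y = mu y * iter t (kop M) h y.
  apply: (mulfI (lt0r_neq0 (mu_gt0 x))).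
  rewrite kpow_iter -[LHS]dot_indic self_adjoint_iter // dotC dot_indic mulrCA.
  congr (_ * _).
  have -> : indic x = fun y => mu x * h y.
    by apply/funext => z; rewrite /h mulrC divfK ?gt_eqF.
  elim: t => //= t IHt in y *; rewrite /kop mulr_sumr; apply: eq_bigr => z _.
  by rewrite mulrCA -IHt.
pose f y := h y - 1.
have f0 : dot f (fun=> 1) = 0.
  have -> : dot f (fun=> 1) = dot (indic x) (fun=> (mu x)^-1) - \sum_y mu y.
    by rewrite -sumrB; apply: eq_bigr => y _; rewrite /f /h; ring.
  by rewrite dot_indic divff ?gt_eqF // mu_sum1 subrr.
pose F := iter t (kop M) f.
have -> : 2 * tv_dist (kpow M t x) mu = dot (fun y => `|F y|) (fun=> 1).
  rewrite /tv_dist mulrA divff ?mul1r //; apply: eq_bigr => y _.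
  rewrite /F iter_kop_sub_cst // mulr1 kpowE -{2}[mu y]mulr1 -mulrBr normrM.
  by rewrite gtr0_norm.
apply: le_trans (dot_Cauchy_Schwarz _ _) _.
have -> : dot (fun=> 1) (fun=> 1) = 1.
  by rewrite -[RHS]mu_sum1; apply: eq_bigr => y _; rewrite !mulr1.
have -> : dot (fun y => `|F y|) (fun y => `|F y|) = dot F F.
  by apply: eq_bigr => y _; rewrite -normrM ger0_norm // -expr2 sqr_ge0.
have FF : dot F F <= gamma ^+ t * dot f f.
  rewrite /F; elim: (t) => [|k IHk] /=; first by rewrite expr0 mul1r.
  rewrite (le_trans (contr _ _)) ?dot1_iter_kop // exprS -mulrA.
  by rewrite ler_wpM2l.
rewrite mulr1 (le_trans FF) // ler_wpM2l ?exprn_ge0 //.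
have -> : dot f f = dot h h - 1.
  have -> : dot f f = dot h h - \sum_y mu y - 2 * dot f (fun=> 1).
    rewrite /dot mulr_sumr -!sumrB; apply: eq_bigr => y _.
    by rewrite /f; ring.
  by rewrite f0 mu_sum1 mulr0 subr0.
have -> : dot h h = (mu x)^-1.
  have -> : dot h h = (mu x)^-1 * dot (indic x) h.
    by rewrite /dot mulr_sumr; apply: eq_bigr => y _; rewrite /h; ring.
  by rewrite dot_indic /h /indic eqxx mul1r divff ?gt_eqF // mulr1.
by rewrite gerBl.
Qed.

End Probability.

(** A nonempty set of naturals attains its infimum, so a finite mixing time is an actual time at
    which the chain is close to [mu]. *)
Lemma mixing_time_fromP M x :
  (exists2 t, tv_dist (kpow M t x) mu <= 4^-1 &
     mixing_time_from M mu x = (t%:R)%:E) \/ mixing_time_from M mu x = +oo%E.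
Proof.
rewrite /mixing_time_from; set P := (X in ereal_inf X).
have [[t Pt]|nP] := pselect (exists t, tv_dist (kpow M t x) mu <= 4^-1).
  have ex : exists t, tv_dist (kpow M t x) mu <= 4^-1 by exists t.
  left; case: (ex_minnP ex) => k Pk kmin; exists k => //.
  apply/eqP; rewrite eq_le; apply/andP; split.
    by apply: ereal_inf_lbound; exists k.
  apply: le_ereal_inf_tmp => _ [j Pj <-]; rewrite lee_fin ler_nat.
  exact: kmin.
right; suff -> : P = set0 by rewrite ereal_inf0.
by apply/seteqP; split=> // y [t Pt _]; apply: nP; exists t.
Qed.

End Reversible.

(** * Edge resampling and the Efron-Stein inequality *)

Section EdgeResampling.
Context {R : realType} {E : finType}.
Implicit Types (A D T : {set E}) (e : E) (f g h : {set E} -> R).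

Lemma set_ind (P : {set E} -> Prop) : P finset.set0 ->
  (forall e T, e \notin T -> P T -> P (e |: T)) -> forall T, P T.
Proof.
move=> P0 PU T; elim: {T}#|T| {-2}T (erefl #|T|) => [|k IHk] T cT.
  by rewrite (cards0_eq cT).
have /card_gt0P[e eT] : (0 < #|T|)%N by rewrite cT.
rewrite -(finset.setD1K eT); apply: PU; first by rewrite !inE eqxx.
by apply: IHk; move: cT; rewrite (cardsD1 e) eT => -[].
Qed.

Lemma setD1_notin e A : e \notin A -> A :\ e = A.
Proof.
move=> eA; apply/setP => x; rewrite !inE.
by case: eqP => // ->; rewrite (negPf eA).
Qed.

(** Configurations are paired by the status of [e]; the heat-bath identities below are then checked
    on each pair. *)
Lemma sum_pair e f : \sum_A f A = \sum_(A : {set E} | e \notin A) (f (e |: A) + f A).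
Proof.
rewrite (bigID (fun A => e \in A)) /= big_split /=; congr (_ + _).
rewrite (reindex_onto (finset.setU [set e]) (fun A => A :\ e)) /=; last first.
  by move=> A eA; rewrite finset.setD1K.
apply: eq_bigl => A; rewrite finset.setU11 /=; apply/eqP/idP => [<-|eA].
  by rewrite !inE eqxx.
exact: finset.setU1K.
Qed.

Definition grad e f A : R := f (e |: A) - f (A :\ e).

(** Mean of [f] after an update of [e] that opens it with probability [g A]. When [g] ignores [e]
    and is balanced for [h], this is the conditional expectation given the other edges. *)
Definition heat_bath g e f A : R := g A * f (e |: A) + (1 - g A) * f (A :\ e).

Section HeatBath.
Variables (h g : {set E} -> R) (e : E).
Hypothesis g_inv : forall A, e \notin A -> g (e |: A) = g A.
Hypothesis balance : forall A, e \notin A -> (1 - g A) * h (e |: A) = g A * h A.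

Let pairE A : e \notin A -> exists s, h (e |: A) = g A * s /\ h A = (1 - g A) * s.
Proof.
move=> eA; exists (h (e |: A) + h A); have := balance eA.
by split; lra.
Qed.

Local Notation K := (heat_bath g e).

Let KE f A : e \notin A -> K f A = g A * f (e |: A) + (1 - g A) * f A.
Proof. by move=> eA; rewrite /heat_bath setD1_notin. Qed.

Let KUE f A : e \notin A -> K f (e |: A) = g A * f (e |: A) + (1 - g A) * f A.
Proof.
move=> eA; rewrite /heat_bath g_inv // finset.setU1K //.
by rewrite finset.setUA finset.setUid.
Qed.

Lemma heat_bath_self_adjoint f f' : dot h f (K f') = dot h (K f) f'.
Proof.
rewrite /dot (sum_pair e) [RHS](sum_pair e); apply: eq_bigr => A eA.
have [s [-> ->]] := pairE eA; rewrite !KUE // !KE //; ring.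
Qed.

Lemma heat_bath_projection f : dot h (K f) (K f) = dot h f (K f).
Proof.
rewrite /dot (sum_pair e) [RHS](sum_pair e); apply: eq_bigr => A eA.
have [s [-> ->]] := pairE eA; rewrite !KUE // !KE //; ring.
Qed.

Lemma heat_bath_stationary f : \sum_A h A * K f A = \sum_A h A * f A.
Proof.
rewrite (sum_pair e) [RHS](sum_pair e); apply: eq_bigr => A eA.
have [s [-> ->]] := pairE eA; rewrite !KUE // !KE //; ring.
Qed.

(** The conditional variance of [f] given the other edges is that of a two-point law with weights
    [g] and [1 - g]. *)
Lemma heat_bath_dirichlet f :
  dot h f f - dot h f (K f) = \sum_A h A * (g A * (1 - g A) * grad e f A ^+ 2).
Proof.
rewrite /dot -sumrB (sum_pair e) [RHS](sum_pair e); apply: eq_bigr => A eA.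
have [s [-> ->]] := pairE eA; rewrite !KUE // !KE // /grad g_inv //.
by rewrite finset.setU1K // finset.setUA finset.setUid setD1_notin //; ring.
Qed.

End HeatBath.

(** Mean of [f] after the elements of [T] are redrawn independently, in the shape of the inner sum
    of [cm_step]. *)
Definition resample (p : R) T f A : R :=
  \sum_(D in powerset T) indep_prob p #|T| #|D| * f ((A :\: T) :|: D).

Section Resample.
Variable p : R.

Lemma resample0 f A : resample p finset.set0 f A = f A.
Proof.
rewrite /resample powerset0 big_set1 /indep_prob cards0 !expr0 !mul1r.
by rewrite finset.setD0 finset.setU0.
Qed.

Lemma sum_powerset_notin e T (F : {set E} -> R) : e \notin T ->
  \sum_(D in powerset T) F D =
  \sum_(D : {set E} | e \notin D) (if D \subset T then F D else 0).
Proof.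
move=> eT; rewrite big_mkcond (sum_pair e) /=; apply: eq_bigr => D eD.
by rewrite !powersetE finset.subUset finset.sub1set (negPf eT) /= add0r.
Qed.

(** The product measure is built one coordinate at a time, which permits induction on [T]. *)
Lemma resampleU1 e T f A : e \notin T ->
  resample p (e |: T) f A = heat_bath (fun=> p) e (resample p T f) A.
Proof.
move=> eT; rewrite /heat_bath /resample !(sum_powerset_notin _ eT) !mulr_sumr.
rewrite -big_split /= big_mkcond (sum_pair e) /=; apply: eq_bigr => D eD.
have -> : (e |: D \in powerset (e |: T)) = (D \subset T).
  rewrite powersetE finset.subUset finset.sub1set finset.setU11 /=.
  by rewrite -{2}(finset.setU1K eT) finset.subsetD1 eD andbT.
have -> : (D \in powerset (e |: T)) = (D \subset T).
  by rewrite powersetE -{2}(finset.setU1K eT) finset.subsetD1 eD andbT.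
case: ifP => [DT|_]; last by rewrite !mulr0.
rewrite /indep_prob !cardsU1 eT eD !add1n subSS (subSn (subset_leq_card DT)).
have -> : A :\: (e |: T) :|: (e |: D) = (e |: A) :\: T :|: D.
  apply/setP => x; rewrite !inE; case: (eqVneq x e) => [->|] //=.
  by rewrite eT.
have -> : A :\: (e |: T) :|: D = (A :\ e) :\: T :|: D.
  by apply/setP => x; rewrite !inE; case: (x == e); rewrite ?andbF.
by rewrite !exprS; ring.
Qed.

Lemma resample_idem T f A D : D \subset T ->
  resample p T f ((A :\: T) :|: D) = resample p T f A.
Proof.
move=> DT; apply: eq_bigr => B _; congr (_ * f (_ :|: B)).
apply/setP => x; rewrite !inE; have := fintype.subsetP DT x.
by case: (x \in D) => [-> //|_]; case: (x \in T); rewrite /= ?orbF.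
Qed.

Lemma resample_setU1 e T f A : e \notin T ->
  resample p T f (e |: A) = resample p T (fun B => f (e |: B)) A.
Proof.
move=> eT; apply: eq_bigr => B _; congr (_ * f _).
apply/setP => x; rewrite !inE; case: (eqVneq x e) => [->|] //=.
by rewrite eT.
Qed.

Lemma resample_setD1 e T f A : e \notin T ->
  resample p T f (A :\ e) = resample p T (fun B => f (B :\ e)) A.
Proof.
move=> eT; rewrite /resample !(sum_powerset_notin _ eT); apply: eq_bigr => D eD.
case: ifP => // _; congr (_ * f _); apply/setP => x; rewrite !inE.
by case: (eqVneq x e) => [->|] //=; rewrite ?eT ?(negPf eD).
Qed.

Lemma resampleB T f g A :
  resample p T (fun B => f B - g B) A = resample p T f A - resample p T g A.
Proof.
by rewrite /resample -sumrB; apply: eq_bigr => D _; rewrite mulrBr.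
Qed.

Lemma resampleD T f g A :
  resample p T (fun B => f B + g B) A = resample p T f A + resample p T g A.
Proof.
by rewrite /resample -big_split; apply: eq_bigr => D _; rewrite mulrDr.
Qed.

Lemma resampleZ T c f A :
  resample p T (fun B => c * f B) A = c * resample p T f A.
Proof.
by rewrite /resample mulr_sumr; apply: eq_bigr => D _; rewrite mulrCA.
Qed.

Lemma resample_cst T c A : resample p T (fun=> c) A = c.
Proof.
move: T A; apply: set_ind => [A|e T eT IH A]; first exact: resample0.
by rewrite resampleU1 // /heat_bath !IH; ring.
Qed.

Lemma grad_resample e T f A : e \notin T ->
  grad e (resample p T f) A = resample p T (grad e f) A.
Proof.
by move=> eT; rewrite /grad resample_setU1 // resample_setD1 // -resampleB.
Qed.

(** A resampled function no longer depends on [T], so it leaves the average as a constant. *)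
Lemma resampleM T f g A :
  resample p T (fun B => f B * resample p T g B) A =
  resample p T f A * resample p T g A.
Proof.
rewrite /resample mulr_suml; apply: eq_bigr => D; rewrite powersetE => DT.
by rewrite -/(resample p T g _) (resample_idem g A DT) mulrA.
Qed.

Section Balance.
Variables (h : {set E} -> R) (T : {set E}).
Hypothesis balance : forall e A, e \in T -> e \notin A ->
  (1 - p) * h (e |: A) = p * h A.

Lemma resample_stationary f : \sum_A h A * resample p T f A = \sum_A h A * f A.
Proof.
move: T balance; apply: set_ind => [_|e T' eT IH bal].
  by apply: eq_bigr => A _; rewrite resample0.
under eq_bigr do rewrite resampleU1 //.
rewrite heat_bath_stationary // => [|A eA]; last first.
  by apply: bal; rewrite ?finset.setU11.
by apply: IH => e' A e'T; apply: bal; rewrite finset.setU1r.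
Qed.

Lemma resample_projection f g :
  dot h f (resample p T g) = dot h (resample p T f) (resample p T g).
Proof.
rewrite /dot -[LHS]resample_stationary; apply: eq_bigr => A _.
by rewrite resampleM.
Qed.

Lemma resample_self_adjoint f g :
  dot h f (resample p T g) = dot h (resample p T f) g.
Proof. by rewrite resample_projection [RHS]dotC [RHS]resample_projection dotC. Qed.

End Balance.

Hypotheses (p_ge0 : 0 <= p) (p_le1 : p <= 1).

Lemma resample_ge0 T f A : (forall B, 0 <= f B) -> 0 <= resample p T f A.
Proof.
move=> f0; apply: sumr_ge0 => D _; apply: mulr_ge0 => //.
by rewrite /indep_prob mulr_ge0 ?exprn_ge0 ?subr_ge0.
Qed.

(** Jensen, as nonnegativity of the variance around [c]. *)
Lemma sqr_resample_le T f A :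
  resample p T f A ^+ 2 <= resample p T (fun B => f B ^+ 2) A.
Proof.
pose c := resample p T f A.
have : 0 <= resample p T (fun B => (f B - c) ^+ 2) A.
  by apply: resample_ge0 => B; exact: sqr_ge0.
have -> : (fun B => (f B - c) ^+ 2) =
          fun B => (f B ^+ 2 - (2 * c) * f B) + c ^+ 2.
  by apply/funext => B; ring.
rewrite resampleD resampleB resampleZ resample_cst -/c; lra.
Qed.

(** Induction on [T] through the law of total variance: a new coordinate [e] adds the Bernoulli
    variance of the conditional mean, and Jensen moves the square inside the average. *)
Lemma Efron_Stein T f A :
  resample p T (fun B => f B ^+ 2) A - resample p T f A ^+ 2 <=
  p * (1 - p) * \sum_(e in T) resample p T (fun B => grad e f B ^+ 2) A.
Proof.
move: T A; apply: set_ind => [A|e T eT IH A].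
  by rewrite !resample0 subrr big_set0 mulr0.
pose V B := resample p T (fun B => f B ^+ 2) B - resample p T f B ^+ 2.
pose K := heat_bath (fun=> p) e.
have -> : resample p (e |: T) (fun B => f B ^+ 2) A -
    resample p (e |: T) f A ^+ 2 =
    K V A + p * (1 - p) * resample p T (grad e f) A ^+ 2.
  by rewrite -grad_resample // !resampleU1 // /K /V /heat_bath /grad; ring.
rewrite big_setU1 //= [leRHS]mulrDr [leRHS]addrC; apply: lerD.
  pose W B := \sum_(e in T) resample p T (fun B => grad e f B ^+ 2) B.
  have -> : \sum_(i in T) resample p (e |: T) (fun B => grad i f B ^+ 2) A = K W A.
    rewrite /K /heat_bath /W !mulr_sumr -big_split /=.
    by apply: eq_bigr => i _; rewrite resampleU1.
  have -> : p * (1 - p) * K W A =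
      p * (p * (1 - p) * W (e |: A)) + (1 - p) * (p * (1 - p) * W (A :\ e)).
    by rewrite /K /heat_bath; ring.
  by apply: lerD; apply: ler_wpM2l; rewrite ?subr_ge0 //; exact: IH.
apply: ler_wpM2l; first by rewrite mulr_ge0 ?subr_ge0.
(* The discrete derivative at [e] does not see the status of [e], so redrawing [e] as well changes
   nothing. *)
have -> : resample p (e |: T) (fun B => grad e f B ^+ 2) A =
          resample p T (fun B => grad e f B ^+ 2) A.
  have inv B C : e |: B = e |: C -> B :\ e = C :\ e -> grad e f B = grad e f C.
    by rewrite /grad => -> ->.
  rewrite resampleU1 // /heat_bath resample_setU1 // resample_setD1 //.
  rewrite -!resampleZ -resampleD; congr (resample _ _ _ _); apply/funext => B.
  rewrite (@inv (e |: B) B) 1?(@inv (B :\ e) B); first by ring.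
  - by apply/setP => x; rewrite !inE; case: eqP.
  - by apply/setP => x; rewrite !inE; case: eqP.
  - by apply/setP => x; rewrite !inE; case: eqP.
  - by apply/setP => x; rewrite !inE; case: eqP.
exact: sqr_resample_le.
Qed.

End Resample.
End EdgeResampling.

(** * Chayes-Machta dynamics *)

Section Components.
Context {V : finType} (adj : rel V).
Implicit Types (A : config adj) (U C : {set V}) (e : edge adj).

Definition component A x : {set V} := [set y | connect (config_adj A) x y].

Lemma edge_val e : exists u v, val e = [set u; v].
Proof.
have /imsetP[[u v] _ ev] := valP e.
by exists u, v.
Qed.

Lemma config_adj_sym A : symmetric (config_adj A).
Proof.
by move=> u v; apply: eq_existsb => f; rewrite finset.setUC.
Qed.

Lemma connect_config_sym A : connect_sym (config_adj A).
Proof. exact/sym_connect_sym/config_adj_sym. Qed.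

Lemma mem_component A x : x \in component A x.
Proof. by rewrite inE connect0. Qed.

Lemma component_eq A x y : y \in component A x -> component A x = component A y.
Proof.
rewrite inE => xy; apply/setP => z; rewrite !inE.
exact: same_connect (connect_config_sym A) _ _ xy z.
Qed.

Lemma componentsP A C : reflect (exists x, C = component A x) (C \in components A).
Proof.
have E x : [set y in [set: V] | connect (config_adj A) x y] = component A x.
  by apply/setP => y; rewrite !inE.
apply: (iffP imsetP) => [[x _ ->]|[x ->]]; first by exists x; rewrite E.
by exists x; rewrite ?inE ?E.
Qed.

Lemma mem_components A x : component A x \in components A.
Proof. by apply/componentsP; exists x. Qed.

Lemma config_adjU1 e A u v :
  config_adj (e |: A) u v = config_adj A u v || (val e == [set u; v]).
Proof.
apply/existsP/orP => [[f /andP[]]|[/existsP[f /andP[fA fuv]]|euv]].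
- rewrite !inE => /orP[/eqP -> ->|fA fuv]; first by right.
  by left; apply/existsP; exists f; rewrite fA.
- by exists f; rewrite !inE fA orbT.
- by exists e; rewrite finset.setU11.
Qed.

(** A closed [U] is a union of components, and an edge inside [U] cannot leave it. *)
Lemma closed_configU1 e A U : val e \subset U ->
  fingraph.closed (config_adj (e |: A)) (mem U) <->
  fingraph.closed (config_adj A) (mem U).
Proof.
move=> eU; split=> cl u v.
  by move=> uv; apply: cl; rewrite config_adjU1 uv.
rewrite config_adjU1 => /orP[/cl //|/eqP ev].
have /fintype.subsetP sU : [set u; v] \subset U by rewrite -ev.
by rewrite !sU // !inE eqxx ?orbT.
Qed.

Lemma closed_component A x : fingraph.closed (config_adj A) (mem (component A x)).
Proof.
move=> u v uv; rewrite /= !inE.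
exact/same_connect_r/connect1/uv/connect_config_sym.
Qed.

Lemma sub_component_closed A U x :
  fingraph.closed (config_adj A) (mem U) -> x \in U ->
  component A x \subset U.
Proof.
move=> cl xU; apply/fintype.subsetP => y; rewrite inE => xy.
by have := closed_connect cl xy; rewrite xU => <-.
Qed.

Lemma component_configU1 e A U x : val e \subset U ->
  fingraph.closed (config_adj A) (mem U) -> x \notin U ->
  component (e |: A) x = component A x.
Proof.
move=> eU cl xU; apply/eqP; rewrite finset.eqEsubset; apply/andP; split.
  apply: sub_component_closed (mem_component A x) => u v.
  rewrite config_adjU1 => /orP[/closed_component //|/eqP ev].
  have /fintype.subsetP sU : [set u; v] \subset U by rewrite -ev.
  have out z : z \in U -> z \in component A x = false.
    move=> zU; apply/negP; rewrite inE => /(fingraph.closed_connect cl).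
    by rewrite /= zU (negPf xU).
  by rewrite /= !out // sU // !inE eqxx ?orbT.
apply: sub_component_closed (mem_component _ x) => u v uv.
by apply: closed_component; rewrite config_adjU1 uv.
Qed.

(** Apart from the component [U] containing [e], every component of [e |: A] is already one of [A],
    and differs from the component of [u] in [A]. *)
Lemma card_components_configU1_le e A :
  (#|components (e |: A)| <= #|components A|)%N.
Proof.
have [u [v ev]] := edge_val e.
set U := component (e |: A) u.
have eU : val e \subset U.
  rewrite ev; apply/fintype.subsetP => x /set2P[] ->; first exact: mem_component.
  by rewrite inE connect1 // config_adjU1 ev eqxx orbT.
have clU : fingraph.closed (config_adj A) (mem U).
  by apply/(closed_configU1 A eU); exact: closed_component.
rewrite (cardsD1 U) mem_components [leqRHS](cardsD1 (component A u)).
rewrite mem_components leq_add2l; apply/subset_leq_card/fintype.subsetP => C.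
rewrite !in_setD1 => /andP[CU /componentsP[x Cx]].
have xU : x \notin U.
  by apply: contraNN CU => /component_eq xu; rewrite Cx -xu.
rewrite Cx (component_configU1 eU clU xU) mem_components andbT.
apply: contraNneq xU => xu; apply: (fintype.subsetP _ x (mem_component A x)).
by rewrite xu; apply: sub_component_closed => //; exact: mem_component.
Qed.

(** Every component of [A] that avoids both endpoints of [e] survives, and the two endpoints account
    for at most two components of [A] against one of [e |: A]. *)
Lemma card_components_configU1_ge e A :
  (#|components A| <= #|components (e |: A)|.+1)%N.
Proof.
have [u [v ev]] := edge_val e.
rewrite (cardsD1 (component A u)) mem_components.
rewrite [leqRHS]/= (cardsD1 (component (e |: A) u) (components (e |: A))).
rewrite mem_components !add1n ltnS.
rewrite (cardsD1 (component A v)) -add1n; apply: leq_add; first exact: leq_b1.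
apply/subset_leq_card/fintype.subsetP => C.
rewrite !in_setD1 => /and3P[Cv Cu /componentsP[x Cx]].
have out z : C != component A z -> z \notin component A x.
  by apply: contraNN => /component_eq <-; rewrite Cx.
have eU : val e \subset ~: component A x.
  by rewrite ev; apply/fintype.subsetP => z /set2P[] ->; rewrite finset.in_setC out.
have clU : fingraph.closed (config_adj A) (mem (~: component A x)).
  by move=> y z /(@closed_component A x) /=; rewrite !finset.in_setC => ->.
have xU : x \notin ~: component A x by rewrite finset.in_setC negbK mem_component.
rewrite Cx -(component_configU1 eU clU xU) mem_components andbT.
apply/eqP => E; have := out _ Cu; rewrite -(component_configU1 eU clU xU) E.
by rewrite mem_component.
Qed.

(** For a closed [U], these are the components left inactive when [U] is the set of active
    vertices. *)
Definition outer_components A U : {set {set V}} :=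
  [set C in components A | ~~ (C \subset U)].

Lemma outer_componentsP A U C : fingraph.closed (config_adj A) (mem U) ->
  reflect (exists2 x, x \notin U & C = component A x)
    (C \in outer_components A U).
Proof.
move=> cl; rewrite inE; apply: (iffP andP) => [[/componentsP[x ->]]|[x xU ->]].
  move=> xU; exists x => //; apply: contraNN xU.
  exact: sub_component_closed.
split; first exact: mem_components.
by apply: contraNN xU => /fintype.subsetP; apply; exact: mem_component.
Qed.

Lemma outer_components_configU1 e A U : val e \subset U ->
  fingraph.closed (config_adj A) (mem U) ->
  outer_components (e |: A) U = outer_components A U.
Proof.
move=> eU cl; have cl' := (closed_configU1 A eU).2 cl.
apply/setP => C; apply/(outer_componentsP _ cl')/(outer_componentsP _ cl).
  by case=> x xU ->; exists x; rewrite ?(component_configU1 eU cl).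
by case=> x xU ->; exists x; rewrite ?(component_configU1 eU cl).
Qed.

Lemma closed_cover A (W : {set {set V}}) : W \subset components A ->
  fingraph.closed (config_adj A) (mem (finset.cover W)).
Proof.
move=> /fintype.subsetP WA.
have half u v : config_adj A u v -> u \in finset.cover W -> v \in finset.cover W.
  move=> uv /finset.bigcupP[C CW uC]; apply/finset.bigcupP; exists C => //.
  have /componentsP[x Cx] := WA _ CW; rewrite Cx in uC *.
  by have := closed_component x uv; rewrite /= uC => <-.
move=> u v uv /=; apply/idP/idP; apply: half => //.
by rewrite config_adj_sym.
Qed.

(** A closed [U] arises from exactly one choice of activated components, so the sum in [activation]
    below reduces to one term. *)
Lemma cover_eq_closed A U (W : {set {set V}}) :
  fingraph.closed (config_adj A) (mem U) ->
  (W \in powerset (components A)) && (finset.cover W == U) =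
  (W == components A :\: outer_components A U).
Proof.
move=> cl; apply/andP/eqP => [[]|->].
  rewrite powersetE => /fintype.subsetP WA /eqP WU; apply/setP => C.
  rewrite !inE; apply/idP/idP => [CW|].
    rewrite (WA _ CW) andbT /= negbK -WU; exact: finset.bigcup_sup CW.
  rewrite negb_and negbK andb_orl => /orP[|]; first by case: (C \in _).
  case/andP=> /fintype.subsetP CU /componentsP[x Cx].
  have : x \in finset.cover W by rewrite WU CU // Cx mem_component.
  case/finset.bigcupP=> D DW; have /componentsP[y Dy] := WA _ DW.
  by rewrite Dy => /component_eq yx; rewrite Cx -yx -Dy.
split; first by rewrite powersetE finset.subsetDl.
apply/eqP/setP => x; apply/finset.bigcupP/idP => [[C]|xU].
  rewrite !inE negb_and negbK andb_orl => /orP[|]; first by case: (C \in _).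
  by case/andP=> /fintype.subsetP CU _ /CU.
exists (component A x); last exact: mem_component.
by rewrite !inE mem_components andbT negbK sub_component_closed.
Qed.

End Components.

(** * Random activation and the Dirichlet form of the Chayes-Machta step *)

Section ChayesMachta.
Context {R : realType} {V : finType} (adj : rel V).
Variables p q : R.
Implicit Types (A : config adj) (U : {set V}) (e : edge adj) (f : config adj -> R).

(** Probability that the active vertices are exactly [U]. Conditioning on vertices rather than on
    components keeps [U] meaningful when an edge inside it flips. *)
Definition activation A U : R :=
  \sum_(W in powerset (components A) | finset.cover W == U)
    indep_prob q^-1 #|components A| #|W|.

(** Each active component contributes [q * q^-1 = 1] and each inactive one [q * (1 - q^-1) = q - 1],
    so only the components outside [U] are seen. *)
Lemma activation_closed A U : 0 < q -> fingraph.closed (config_adj A) (mem U) ->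
  q ^+ #|components A| * activation A U = (q - 1) ^+ #|outer_components A U|.
Proof.
move=> q0 cl; rewrite /activation.
rewrite (eq_bigl _ _ (fun W => cover_eq_closed W cl)) big_pred1_eq.
have sO : outer_components A U \subset components A.
  by apply/fintype.subsetP => C; rewrite inE => /andP[].
rewrite /indep_prob cardsD (finset.setIidPr sO).
rewrite subKn ?subset_leq_card //.
set c := #|components A|; set o := #|_|.
have oc : (o <= c)%N by exact: subset_leq_card.
have -> : q - 1 = q * (1 - q^-1) by rewrite mulrBr mulr1 mulfV ?gt_eqF.
rewrite -{1}(subnK oc) exprD exprMn exprVn mulrACA.
by rewrite mulfV ?mul1r // expf_neq0 // gt_eqF.
Qed.

Lemma activation_not_closed A U : ~ fingraph.closed (config_adj A) (mem U) ->
  activation A U = 0.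
Proof.
move=> ncl; rewrite /activation big1 // => W /andP[].
rewrite powersetE => WA /eqP WU; case: ncl; rewrite -WU.
exact: closed_cover.
Qed.

Lemma activation_configU1 e A U : 0 < q -> val e \subset U ->
  q ^+ #|components (e |: A)| * activation (e |: A) U =
  q ^+ #|components A| * activation A U.
Proof.
move=> q0 eU; have [cl|ncl] := pselect (fingraph.closed (config_adj A) (mem U)).
  have cl' := (closed_configU1 A eU).2 cl.
  by rewrite (activation_closed q0 cl) (activation_closed q0 cl')
    outer_components_configU1.
rewrite !activation_not_closed ?mulr0 // => cl.
exact/ncl/(closed_configU1 A eU).
Qed.

Hypotheses (p_gt0 : 0 < p) (p_lt1 : p < 1) (q_gt1 : 1 < q).

Let q_gt0 : 0 < q. Proof. exact: lt_trans q_gt1. Qed.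

Lemma activation_ge0 A U : 0 <= activation A U.
Proof.
apply: sumr_ge0 => W _; rewrite /indep_prob.
by rewrite mulr_ge0 ?exprn_ge0 ?subr_ge0 ?invf_le1 ?invr_ge0 // ltW.
Qed.

Lemma sum_activation A : \sum_U activation A U = 1.
Proof.
rewrite /activation -(@partition_big _ _ _ _ _ _ _ (@finset.cover V) xpredT) //.
(* Total mass 1 of a product measure, here over components with bias [q^-1] in place of edges. *)
rewrite -[RHS](resample_cst q^-1 (components A) 1 finset.set0).
by apply: eq_bigr => W _; rewrite mulr1.
Qed.

Lemma rc_weight_gt0 A : 0 < rc_weight p q A.
Proof. by rewrite !mulr_gt0 ?exprn_gt0 ?subr_gt0. Qed.

Lemma rc_partition_gt0 : 0 < \sum_(B : config adj) rc_weight p q B.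
Proof.
rewrite (bigD1 finset.set0) //= ltr_wpDr ?rc_weight_gt0 //.
by apply: sumr_ge0 => B _; exact/ltW/rc_weight_gt0.
Qed.

Lemma rc_measure_gt0 A : 0 < rc_measure adj p q A.
Proof. by rewrite divr_gt0 ?rc_weight_gt0 ?rc_partition_gt0. Qed.

Lemma sum_rc_measure : \sum_A rc_measure adj p q A = 1.
Proof. by rewrite -mulr_suml mulfV // gt_eqF ?rc_partition_gt0. Qed.

(** The ratio of the two weights, cross-multiplied so that the change in the number of components
    needs no sign. *)
Lemma rc_weight_configU1 e A : e \notin A ->
  (1 - p) * (rc_weight p q (e |: A) * q ^+ #|components A|) =
  p * (rc_weight p q A * q ^+ #|components (e |: A)|).
Proof.
move=> eA; rewrite /rc_weight cardsU1 eA add1n.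
have lt : (#|A| < #|edge adj|)%N.
  by have := max_card (mem (e |: A)); rewrite cardsU1 eA.
have -> : (#|edge adj| - #|A| = (#|edge adj| - #|A|.+1).+1)%N by rewrite subnSK.
have alg a b c d : (1 - p) * (p ^+ a.+1 * (1 - p) ^+ b * q ^+ c * q ^+ d) =
    p * (p ^+ a * (1 - p) ^+ b.+1 * q ^+ d * q ^+ c).
  by rewrite !exprS; ring.
exact: alg.
Qed.

(** Joint law of the configuration and its set of active vertices. *)
Definition joint U A : R := rc_measure adj p q A * activation A U.

Lemma joint_ge0 U A : 0 <= joint U A.
Proof. by rewrite mulr_ge0 ?activation_ge0 // ltW // rc_measure_gt0. Qed.

(* Activating components with probability [1/q] exactly cancels their weight,
   so the edges inside [U] are independent given [U] and the other edges. *)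
Lemma joint_balance U e A : e \in edges_within adj U -> e \notin A ->
  (1 - p) * joint U (e |: A) = p * joint U A.
Proof.
rewrite inE => eU eA; have act := activation_configU1 A q_gt0 eU.
have wgt := rc_weight_configU1 eA.
have alg w1 w0 k1 k0 a1 a0 z : k0 != 0 -> k1 != 0 ->
    (1 - p) * (w1 * k0) = p * (w0 * k1) -> k1 * a1 = k0 * a0 ->
    (1 - p) * (w1 / z * a1) = p * (w0 / z * a0) :> R.
  move=> k0n k1n eqw eqa; apply: (mulfI k0n); apply: (mulfI k1n).
  transitivity ((1 - p) * (w1 * k0) / z * (k1 * a1)); first by ring.
  by rewrite eqw eqa; ring.
by apply: alg wgt act; rewrite expf_neq0 // gt_eqF.
Qed.

Lemma kop_cm_step f A :
  kop (cm_step adj p q) f A =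
  \sum_U activation A U * resample p (edges_within adj U) f A.
Proof.
transitivity (\sum_(W in powerset (components A))
    indep_prob q^-1 #|components A| #|W| *
    resample p (edges_within adj (finset.cover W)) f A).
  rewrite /kop /cm_step; under eq_bigr do rewrite mulr_suml.
  rewrite exchange_big /=; apply: eq_bigr => W _.
  under eq_bigr do rewrite -mulrA.
  rewrite -mulr_sumr; congr (_ * _); under eq_bigr do rewrite mulr_suml.
  rewrite exchange_big /=; apply: eq_bigr => D _.
  under eq_bigr do rewrite -mulrA.
  rewrite -mulr_sumr; congr (_ * _).
  by rewrite -[RHS](sum_indic f); apply: eq_bigr => B _; rewrite mulrC.
(* The choices of activated components are grouped by the vertex set that they cover. *)
rewrite (@partition_big _ _ _ _ _ _ _ (@finset.cover V) xpredT) //=.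
apply: eq_bigr => U _; rewrite /activation mulr_suml.
by apply: eq_bigr => W /andP[_ /eqP ->].
Qed.

Lemma cm_step_stochastic : stochastic (cm_step adj p q).
Proof.
split=> [A B|A].
  rewrite -kop_indic kop_cm_step; apply: sumr_ge0 => U _.
  apply: mulr_ge0; first exact: activation_ge0.
  by apply: resample_ge0 => [||C]; rewrite ?ler0n // ltW.
have -> : \sum_B cm_step adj p q A B = kop (cm_step adj p q) (fun=> 1) A.
  by apply: eq_bigr => B _; rewrite mulr1.
rewrite kop_cm_step -[RHS](sum_activation A); apply: eq_bigr => U _.
by rewrite resample_cst mulr1.
Qed.

Lemma dot_kop_cm_step f f' :
  dot (rc_measure adj p q) f (kop (cm_step adj p q) f') =
  \sum_U dot (joint U) f (resample p (edges_within adj U) f').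
Proof.
rewrite exchange_big /=; apply: eq_bigr => A _.
rewrite kop_cm_step !mulr_sumr; apply: eq_bigr => U _.
by rewrite /joint; ring.
Qed.

Lemma dot_rc_measure_joint f f' :
  dot (rc_measure adj p q) f f' = \sum_U dot (joint U) f f'.
Proof.
rewrite exchange_big /=; apply: eq_bigr => A _.
by rewrite -mulr_suml -mulr_sumr sum_activation mulr1.
Qed.

Lemma cm_step_self_adjoint : self_adjoint (rc_measure adj p q) (cm_step adj p q).
Proof.
move=> f f'; rewrite [RHS]dotC !dot_kop_cm_step; apply: eq_bigr => U _.
rewrite [RHS]dotC; apply: resample_self_adjoint => e A; exact: joint_balance.
Qed.

(** For each [U] the form is a mean conditional variance, because resampling is a projection for
    [joint U]; Efron-Stein then applies. *)
Lemma cm_step_dirichlet_le f :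
  dot (rc_measure adj p q) f f - dot (rc_measure adj p q) f (kop (cm_step adj p q) f)
  <= p * (1 - p) * \sum_A rc_measure adj p q A * \sum_e grad e f A ^+ 2.
Proof.
rewrite dot_rc_measure_joint dot_kop_cm_step -sumrB.
have -> : \sum_A rc_measure adj p q A * \sum_e grad e f A ^+ 2 =
    \sum_U \sum_A joint U A * \sum_e grad e f A ^+ 2.
  rewrite [RHS]exchange_big /=; apply: eq_bigr => A _.
  by rewrite -mulr_suml -mulr_sumr sum_activation mulr1.
rewrite mulr_sumr; apply: ler_sum => U _.
set T := edges_within adj U.
have bal e A : e \in T -> e \notin A -> (1 - p) * joint U (e |: A) = p * joint U A.
  exact: joint_balance.
have -> : dot (joint U) f f - dot (joint U) f (resample p T f) =
    \sum_A joint U A * (resample p T (fun B => f B ^+ 2) A - resample p T f A ^+ 2).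
  rewrite (resample_projection bal).
  under [RHS]eq_bigr do rewrite mulrBr.
  by rewrite sumrB (resample_stationary bal).
apply: (@le_trans _ _ (\sum_A joint U A * (p * (1 - p) *
    \sum_(e in T) resample p T (fun B => grad e f B ^+ 2) A))).
  apply: ler_sum => A _; rewrite ler_wpM2l ?joint_ge0 //.
  by apply: Efron_Stein; exact: ltW.
(* Stationarity of [joint U] under resampling removes the inner average. *)
have -> : \sum_A joint U A * (p * (1 - p) *
    \sum_(e in T) resample p T (fun B => grad e f B ^+ 2) A) =
    p * (1 - p) * \sum_A joint U A * \sum_(e in T) grad e f A ^+ 2.
  under eq_bigr do rewrite mulrCA mulr_sumr.
  rewrite -mulr_sumr; congr (_ * _).
  under [RHS]eq_bigr do rewrite mulr_sumr.
  rewrite exchange_big [RHS]exchange_big /=; apply: eq_bigr => e _.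
  exact: (resample_stationary bal).
apply: ler_wpM2l; first by apply: mulr_ge0; rewrite ?subr_ge0 ltW.
apply: ler_sum => A _; rewrite ler_wpM2l ?joint_ge0 //.
rewrite [leRHS](bigID (mem T)) /= lerDl; apply: sumr_ge0 => e _.
exact: sqr_ge0.
Qed.

End ChayesMachta.

(** * Glauber dynamics *)

Section Glauber.
Context {R : realType} {V : finType} (adj : rel V).
Variables p q : R.
Hypotheses (p_gt0 : 0 < p) (p_lt1 : p < 1) (q_gt1 : 1 < q).
Implicit Types (A : config adj) (e : edge adj) (f : config adj -> R).

Let mu := rc_measure adj p q.
Let m : R := #|edge adj|%:R.
Let g e A : R := glauber_open_prob p q A e.

Let q_gt0 : 0 < q. Proof. exact: lt_trans q_gt1. Qed.

Let mu_gt0 A : 0 < mu A. Proof. exact: rc_measure_gt0. Qed.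

Lemma setUD1 (E : finType) (e : E) (A : {set E}) : e |: (A :\ e) = e |: A.
Proof. by apply/setP => x; rewrite !inE; case: eqP. Qed.

(** [theta] is [q] to the power of the change in the number of components, which is 0 or -1 when [e]
    is opened. *)
Lemma rc_weight_open_ratio e A : exists s theta,
  [/\ 0 < s, q^-1 <= theta, theta <= 1,
      rc_weight p q (e |: A) = p * theta * s &
      rc_weight p q (A :\ e) = (1 - p) * s].
Proof.
have eA : e \notin A :\ e by rewrite !inE eqxx.
have := rc_weight_configU1 p q eA.
have := card_components_configU1_le e (A :\ e).
have := card_components_configU1_ge e (A :\ e).
have := rc_weight_gt0 p_gt0 p_lt1 q_gt1 (A :\ e).
rewrite setUD1; move: #|components (e |: A)| #|components (A :\ e)|.
move: (rc_weight p q (e |: A)) (rc_weight p q (A :\ e)) => w1 w0 c1 c0.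
move=> w0_gt0 c01 c10 bal.
have p1 : 0 < 1 - p by rewrite subr_gt0.
have q1 : 1 <= q := ltW q_gt1.
have qc0 : 0 < q ^+ c0 by rewrite exprn_gt0.
have kl : q ^+ c0 <= q * q ^+ c1 by rewrite -exprS ler_weXn2l.
have kr : q ^+ c1 <= q ^+ c0 by rewrite ler_weXn2l.
move: (q ^+ c0) (q ^+ c1) bal qc0 kl kr => k0 k1 bal qc0 kl kr.
exists (w0 / (1 - p)), (k1 / k0); split.
- by rewrite divr_gt0.
- by rewrite ler_pdivlMr // ler_pdivrMl.
- by rewrite ler_pdivrMr // mul1r.
- apply: (mulfI (lt0r_neq0 p1)); apply: (mulIf (lt0r_neq0 qc0)).
  by rewrite -[LHS]mulrA bal; field; rewrite !gt_eqF.
- by field; rewrite gt_eqF.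
Qed.

Lemma glauber_open_probE e A :
  g e A = rc_weight p q (e |: A) / (rc_weight p q (e |: A) + rc_weight p q (A :\ e)).
Proof.
have /lt0r_neq0 Z := rc_partition_gt0 adj p_gt0 p_lt1 q_gt1.
by rewrite /g /glauber_open_prob /rc_measure -mulrDl invf_div mulrA divfK.
Qed.

Lemma glauber_open_prob_ge0 e A : 0 <= g e A.
Proof.
by rewrite glauber_open_probE divr_ge0 ?addr_ge0 // ltW // rc_weight_gt0.
Qed.

Lemma glauber_open_prob_le e A : g e A <= p.
Proof.
rewrite glauber_open_probE.
have [s [theta [s0 qt t1 -> ->]]] := rc_weight_open_ratio e A.
have t0 : 0 < theta by rewrite (lt_le_trans _ qt) ?invr_gt0.
have d0 : 0 < p * theta * s + (1 - p) * s.
  by rewrite addr_gt0 ?mulr_gt0 ?subr_gt0.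
rewrite ler_pdivrMr // -subr_ge0.
have -> : p * (p * theta * s + (1 - p) * s) - p * theta * s =
  p * (1 - p) * s * (1 - theta) by ring.
by rewrite !mulr_ge0 ?subr_ge0 // ltW.
Qed.

(** The product [g * (1 - g)] is [p * (1 - p) * theta] over a square at most 1, and [theta >= q^-1];
    this is the only loss of a factor [q]. *)
Lemma glauber_open_prob_var e A : p * (1 - p) <= q * (g e A * (1 - g e A)).
Proof.
rewrite glauber_open_probE.
have [s [theta [s0 qt t1 -> ->]]] := rc_weight_open_ratio e A.
have t0 : 0 < theta by rewrite (lt_le_trans _ qt) ?invr_gt0.
have d0 : 0 < p * theta + (1 - p) by rewrite addr_gt0 ?mulr_gt0 ?subr_gt0.
have d1 : p * theta + (1 - p) <= 1.
  have : p * theta <= p * 1 by rewrite ler_wpM2l // ltW.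
  lra.
have -> : p * theta * s / (p * theta * s + (1 - p) * s) *
  (1 - p * theta * s / (p * theta * s + (1 - p) * s)) =
  p * (1 - p) * theta / (p * theta + (1 - p)) ^+ 2.
  by field; rewrite -mulrDl mulf_neq0 gt_eqF.
have pp : 0 < p * (1 - p) by rewrite mulr_gt0 ?subr_gt0.
rewrite mulrA ler_pdivlMr ?exprn_gt0 //.
apply: (@le_trans _ _ (p * (1 - p) * 1)).
  apply: ler_wpM2l; first exact: ltW.
  by rewrite exprn_ile1 // ltW.
have -> : q * (p * (1 - p) * theta) = p * (1 - p) * (q * theta) by ring.
apply: ler_wpM2l; first exact: ltW.
by rewrite -ler_pdivrMl // mulr1.
Qed.

Lemma glauber_open_prob_inv e A : e \notin A -> g e (e |: A) = g e A.
Proof.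
move=> eA; have E1 : e |: (e |: A) = e |: A by rewrite finset.setUA finset.setUid.
have E2 : (e |: A) :\ e = A :\ e by rewrite finset.setU1K // setD1_notin.
by rewrite /g /glauber_open_prob E1 E2.
Qed.

Lemma glauber_open_prob_balance e A : e \notin A ->
  (1 - g e A) * mu (e |: A) = g e A * mu A.
Proof.
move=> eA; rewrite /g /glauber_open_prob (setD1_notin eA).
have := mu_gt0 (e |: A); have := mu_gt0 A; rewrite /mu.
move: (rc_measure adj p q A) (rc_measure adj p q (e |: A)) => u v u0 v0.
by field; rewrite gt_eqF // addr_gt0.
Qed.

Lemma kop_glauber_step f A :
  kop (glauber_step adj p q) f A = m^-1 * \sum_(e : edge adj) heat_bath (g e) e f A.
Proof.
rewrite /kop /glauber_step; under eq_bigr do rewrite -mulrA mulr_suml.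
rewrite -mulr_sumr exchange_big /=; congr (_ * _); apply: eq_bigr => e _.
rewrite /heat_bath -(sum_indic f (e |: A)) -(sum_indic f (A :\ e)).
rewrite !mulr_sumr -big_split /=; apply: eq_bigr => B _.
by rewrite /g; ring.
Qed.

Lemma glauber_step_self_adjoint : self_adjoint mu (glauber_step adj p q).
Proof.
have E f f' : dot mu f (kop (glauber_step adj p q) f') =
    m^-1 * \sum_(e : edge adj) dot mu f (heat_bath (g e) e f').
  rewrite exchange_big mulr_sumr /=; apply: eq_bigr => A _.
  by rewrite kop_glauber_step -!mulr_sumr; ring.
move=> f f'; rewrite E dotC E; congr (_ * _); apply: eq_bigr => e _.
rewrite [RHS]dotC; apply: heat_bath_self_adjoint.
  exact: glauber_open_prob_inv.
exact: glauber_open_prob_balance.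
Qed.

Hypothesis m_gt0 : 0 < m.

Lemma glauber_step_stochastic : stochastic (glauber_step adj p q).
Proof.
split=> [A B|A].
  rewrite /glauber_step mulr_ge0 ?invr_ge0 ?ler0n //; apply: sumr_ge0 => e _.
  have g0 := glauber_open_prob_ge0 e A.
  have g1 : g e A <= 1 := le_trans (glauber_open_prob_le e A) (ltW p_lt1).
  by rewrite addr_ge0 // mulr_ge0 ?ler0n // subr_ge0.
have -> : \sum_B glauber_step adj p q A B = kop (glauber_step adj p q) (fun=> 1) A.
  by apply: eq_bigr => B _; rewrite mulr1.
rewrite kop_glauber_step.
have -> : \sum_(e : edge adj) heat_bath (g e) e (fun=> 1) A = m.
  rewrite /m -sum1_card natr_sum; apply: eq_bigr => e _.
  by rewrite /heat_bath; ring.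
by rewrite mulVf ?gt_eqF.
Qed.

(* An average of the projections [heat_bath] is a self-adjoint operator whose
   square is below it, by Jensen. *)
Lemma glauber_step_contracts f :
  dot mu (kop (glauber_step adj p q) f) (kop (glauber_step adj p q) f) <=
  dot mu f (kop (glauber_step adj p q) f).
Proof.
have -> : dot mu f (kop (glauber_step adj p q) f) =
    \sum_A mu A * (m^-1 * \sum_(e : edge adj) heat_bath (g e) e f A ^+ 2).
  transitivity (m^-1 * \sum_(e : edge adj) dot mu f (heat_bath (g e) e f)).
    rewrite exchange_big mulr_sumr /=; apply: eq_bigr => A _.
    by rewrite kop_glauber_step -!mulr_sumr; ring.
  under [RHS]eq_bigr do rewrite mulrCA mulr_sumr.
  rewrite -mulr_sumr [X in _ = _ * X]exchange_big /=; congr (_ * _).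
  apply: eq_bigr => e _; rewrite -(heat_bath_projection (@glauber_open_prob_inv e)
    (@glauber_open_prob_balance e)).
  by apply: eq_bigr => A _; rewrite expr2.
apply: ler_sum => A _; apply: ler_wpM2l; first exact/ltW/mu_gt0.
rewrite kop_glauber_step; set S := \sum_(e : edge adj) _.
have -> : m^-1 * S * (m^-1 * S) = m^-1 * (m^-1 * S ^+ 2) by ring.
apply: ler_wpM2l; first by rewrite invr_ge0 ltW.
by rewrite ler_pdivrMl // sqr_sum_le_card.
Qed.

(** Both forms are compared edge by edge; the factor [m] pays for the uniform choice of one edge by
    Glauber. *)
Lemma cm_dirichlet_le_glauber f :
  dot mu f f - dot mu f (kop (cm_step adj p q) f) <=
  q * m * (dot mu f f - dot mu f (kop (glauber_step adj p q) f)).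
Proof.
apply: le_trans (cm_step_dirichlet_le _ _ _ _) _ => //.
have -> : dot mu f f - dot mu f (kop (glauber_step adj p q) f) =
    m^-1 * \sum_(e : edge adj) \sum_A mu A * (g e A * (1 - g e A) * grad e f A ^+ 2).
  transitivity (m^-1 * \sum_(e : edge adj) 
    (dot mu f f - dot mu f (heat_bath (g e) e f))).
    rewrite sumrB mulrBr; congr (_ - _).
      by rewrite sumr_const -[_ *+ #|_|]mulr_natl mulrA mulVf ?mul1r ?gt_eqF.
    rewrite exchange_big mulr_sumr /=; apply: eq_bigr => A _.
    by rewrite kop_glauber_step -!mulr_sumr; ring.
  congr (_ * _); apply: eq_bigr => e _; apply: heat_bath_dirichlet.
    exact: glauber_open_prob_inv.
  exact: glauber_open_prob_balance.
rewrite mulrA mulfK ?gt_eqF // exchange_big /= !mulr_sumr.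
apply: ler_sum => A _; rewrite mulrCA -!mulr_sumr [leRHS]mulrCA.
rewrite (ler_wpM2l (ltW (mu_gt0 A))) // !mulr_sumr; apply: ler_sum => e _.
by rewrite [leRHS]mulrA ler_wpM2r ?sqr_ge0 ?glauber_open_prob_var.
Qed.

(** By [glauber_step_contracts] the squared norm of the image is at most the quadratic form, so the
    gap also controls the bottom of the spectrum. *)
Lemma glauber_step_spectral_gap T f : (0 < T)%N ->
  (forall A, tv_dist (kpow (cm_step adj p q) T A) mu <= 4^-1) ->
  dot mu f (fun=> 1) = 0 ->
  dot mu (kop (glauber_step adj p q) f) (kop (glauber_step adj p q) f) <=
  (1 - (2 * q * m * T%:R)^-1) * dot mu f f.
Proof.
move=> T0 mix f0.
have T0' : 0 < T%:R :> R by rewrite ltr0n.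
have gap := mixed_spectral_gap mu_gt0 (sum_rc_measure _ p_gt0 p_lt1 q_gt1)
  (cm_step_stochastic _ p_gt0 p_lt1 q_gt1)
  (cm_step_self_adjoint p q_gt1) T0 mix f0.
have c0 : 0 < 2 * q * m * T%:R by rewrite !mulr_gt0.
have : (2 * q * m * T%:R)^-1 * dot mu f f <=
    dot mu f f - dot mu f (kop (glauber_step adj p q) f).
  rewrite ler_pdivrMl //; apply: (le_trans gap).
  have -> : 2 * q * m * T%:R * (dot mu f f - dot mu f (kop (glauber_step adj p q) f))
    = 2 * T%:R * (q * m * (dot mu f f - dot mu f (kop (glauber_step adj p q) f))).
    by ring.
  by rewrite ler_wpM2l ?mulr_ge0 ?cm_dirichlet_le_glauber // ltW.
have := glauber_step_contracts f; lra.
Qed.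

(** One step selects each open edge with probability [m^-1] and leaves the selected edge open with
    probability at most [p], so the mean excess over [p * m] contracts. *)
Lemma kop_glauber_card A :
  kop (glauber_step adj p q) (fun B => #|B|%:R - p * m) A <=
  (1 - m^-1) * (#|A|%:R - p * m).
Proof.
rewrite kop_sub_cst; last exact: glauber_step_stochastic.
rewrite kop_glauber_step.
suff : m^-1 * \sum_(e : edge adj) heat_bath (g e) e (fun B => #|B|%:R) A <=
    m^-1 * (\sum_(e : edge adj) (#|A|%:R + p) - #|A|%:R).
  rewrite sumr_const -[_ *+ #|_|]mulr_natl -/m.
  have -> : m^-1 * (m * (#|A|%:R + p) - #|A|%:R) =
            (1 - m^-1) * (#|A|%:R - p * m) + p * m.
    by field; rewrite gt_eqF.
  lra.
apply: ler_wpM2l; first by rewrite invr_ge0 ltW.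
have -> : #|A|%:R = \sum_(e : edge adj) (e \in A)%:R :> R.
  rewrite -sum1_card natr_sum big_mkcond /=; apply: eq_bigr => e _.
  by case: (e \in A).
rewrite -sumrB; apply: ler_sum => e _.
rewrite /heat_bath -setUD1 cardsU1 !inE eqxx /= natrD.
have -> : \sum_(e : edge adj) (e \in A)%:R = #|A|%:R :> R.
  rewrite -sum1_card natr_sum [RHS]big_mkcond /=; apply: eq_bigr => e' _.
  by case: (e' \in A).
have -> : #|A|%:R = (e \in A)%:R + #|A :\ e|%:R :> R.
  by rewrite (cardsD1 e A) natrD.
have := glauber_open_prob_le e A; lra.
Qed.

Lemma iter_glauber_card s A :
  \sum_B kpow (glauber_step adj p q) s A B * #|B|%:R <=
  p * m + m * (1 - m^-1) ^+ s.
Proof.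
have m1 : 1 <= m by rewrite /m ler1n -(ltr0n R).
have m1' : 0 <= 1 - m^-1 by rewrite subr_ge0 invf_le1.
have HM := glauber_step_stochastic.
suff : iter s (kop (glauber_step adj p q)) (fun B => #|B|%:R - p * m) A <=
    (1 - m^-1) ^+ s * (#|A|%:R - p * m).
  rewrite iter_kop_sub_cst // -kpow_kop => H.
  have : (1 - m^-1) ^+ s * (#|A|%:R - p * m) <= (1 - m^-1) ^+ s * m.
    rewrite ler_wpM2l ?exprn_ge0 // lerBlDr (@le_trans _ _ m) //.
      by rewrite ler_nat max_card.
    by rewrite lerDl mulr_ge0 // ltW.
  move: H; lra.
elim: s A => [|s IH] A /=; first by rewrite expr0 mul1r.
apply: (@le_trans _ _ ((1 - m^-1) ^+ s *
    kop (glauber_step adj p q) (fun B => #|B|%:R - p * m) A)).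
  rewrite /kop mulr_sumr; apply: ler_sum => B _.
  by rewrite mulrCA ler_wpM2l // (HM.1).
by rewrite exprSr -mulrA ler_wpM2l ?exprn_ge0 ?kop_glauber_card.
Qed.

(** Markov's inequality. If [p * m >= 16^-1], the mean is at most [2 * p * m]; otherwise the mean is
    below [8^-1] and already bounds the probability of any open edge. *)
Lemma glauber_sparse_whp s A : m * (1 - m^-1) ^+ s <= 16^-1 ->
  \sum_B kpow (glauber_step adj p q) s A B * (32 * p * m < #|B|%:R)%R%:R <= 8^-1.
Proof.
move=> small.
have [K0 K1] := kpow_stochastic s glauber_step_stochastic.
have card := iter_glauber_card s A.
have pm0 : 0 < p * m by rewrite mulr_gt0.
have [pm|pm] := leP 16^-1 (p * m).
  have c0 : 0 < 32 * p * m by rewrite -mulrA mulr_gt0.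
  apply: (@le_trans _ _ (\sum_B kpow (glauber_step adj p q) s A B *
      (#|B|%:R / (32 * p * m)))).
    apply: ler_sum => B _; apply: ler_wpM2l => //.
    case: ltP => [lt|_]; last by rewrite divr_ge0 ?ler0n // ltW.
    by rewrite ler_pdivlMr // mul1r ltW.
  under eq_bigr do rewrite mulrA.
  by rewrite -mulr_suml ler_pdivrMr //; move: card; lra.
apply: (@le_trans _ _ (\sum_B kpow (glauber_step adj p q) s A B * #|B|%:R)).
  apply: ler_sum => B _; rewrite ler_wpM2l // ler_nat.
  case: ltP => // lt; rewrite -(ltr0n R); apply: le_lt_trans lt.
  by rewrite -mulrA mulr_ge0 // ltW.
move: card; lra.
Qed.

End Glauber.

(** * Mixing of the Glauber dynamics *)

Section Estimates.
Context {R : realType}.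
Implicit Types x y p : R.

Lemma ln_le_sub1 x : 0 < x -> ln x <= x - 1.
Proof.
by move=> x0; have := expR_ge1Dx (ln x); rewrite lnK ?posrE //; lra.
Qed.

Lemma geometric_decay x y t : x <= 1 -> 0 < y -> ln y + 15 <= t%:R * x ->
  y * (1 - x) ^+ t <= 16^-1.
Proof.
move=> x1 y0 yt.
have x1' : 1 - x <= expR (- x) by have := expR_ge1Dx (- x); lra.
have -> : y * (1 - x) ^+ t = expR (ln y) * (1 - x) ^+ t by rewrite lnK ?posrE.
apply: (@le_trans _ _ (expR (ln y) * expR (- x) ^+ t)).
  by rewrite ler_wpM2l ?expR_ge0 // lerXn2r ?nnegrE ?subr_ge0 ?expR_ge0.
rewrite -expRM_natl -expRD; apply: (@le_trans _ _ (expR (- 15))).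
  by rewrite ler_expR; lra.
(* The constant 15 is chosen for [expR 15 >= 1 + 15]. *)
rewrite expRN lef_pV2 ?posrE ?expR_gt0 //.
by have := expR_ge1Dx (15 : R); lra.
Qed.

(** The last bound keeps the factor [p] in the cost of closed edges: for [p <= 2^-1] it follows from
    [- ln (1 - p) <= 2 * p], and otherwise [4 * p >= 1]. *)
Lemma ln_inv_min_bounds p : 0 < p -> p < 1 ->
  let L := ln (1 / Num.min p (1 - p)) in
  [/\ 2^-1 <= L, - ln p <= L, - ln (1 - p) <= L & - ln (1 - p) <= 4 * p * L].
Proof.
move=> p0 p1 L; have p1' : 0 < 1 - p by rewrite subr_gt0.
have Lp : - ln p <= L.
  rewrite /L -lnV ?posrE // ler_ln ?posrE ?divr_gt0 ?lt_min ?p0 ?invr_gt0 //.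
  by rewrite div1r lef_pV2 ?posrE ?lt_min ?p0 ?ge_min ?lexx.
have Lp' : - ln (1 - p) <= L.
  rewrite /L -lnV ?posrE // ler_ln ?posrE ?divr_gt0 ?lt_min ?p0 ?invr_gt0 //.
  by rewrite div1r lef_pV2 ?posrE ?lt_min ?p0 ?ge_min ?lexx ?orbT.
have L2 : 2^-1 <= L.
  have [ph|ph] := leP p 2^-1; first by have := ln_le_sub1 p0; lra.
  by have := ln_le_sub1 p1'; lra.
split=> //; have [ph|ph] := leP p 2^-1; last first.
  have : 1 * L <= 4 * p * L by rewrite ler_wpM2r //; lra.
  lra.
have : - ln (1 - p) <= 2 * p.
  rewrite -lnV ?posrE //; apply: (le_trans (ln_le_sub1 _)); rewrite ?invr_gt0 //.
  rewrite lerBlDr -div1r ler_pdivrMr //.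
  have : 0 <= p * (1 - 2 * p) by rewrite mulr_ge0; lra.
  lra.
have : 4 * p * 2^-1 <= 4 * p * L by rewrite ler_wpM2l // mulr_ge0 // ltW.
lra.
Qed.

Lemma nat_ceil x : 0 <= x -> exists k : nat, x <= k%:R /\ k%:R <= x + 1.
Proof.
move=> x0; exists (Num.truncn x).+1; rewrite ltW ?truncnS_gt //.
by rewrite -natr1 lerD2r truncn_le.
Qed.

End Estimates.

(** * Burn-in to sparse configurations, then $L^2$ relaxation *)

Section Comparison.
Context {R : realType} {V : finType} (adj : rel V).
Variables p q : R.
Hypotheses (p_gt0 : 0 < p) (p_lt1 : p < 1) (q_gt1 : 1 < q).
Implicit Types (A : config adj).

Let mu := rc_measure adj p q.
Let m : R := #|edge adj|%:R.
Let n : R := #|V|%:R.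
Let L := ln (1 / Num.min p (1 - p)).

Let q_gt0 : 0 < q. Proof. exact: lt_trans q_gt1. Qed.

Lemma card_components_le A : (#|components A| <= #|V|)%N.
Proof. by rewrite -cardsT leq_imset_card. Qed.

(** At most [#|V|] components occur, and the remaining Bernoulli weights sum to 1. *)
Lemma rc_partition_le : \sum_(B : config adj) rc_weight p q B <= q ^+ #|V|.
Proof.
have -> : q ^+ #|V| = q ^+ #|V| *
    \sum_(B : config adj) p ^+ #|B| * (1 - p) ^+ (#|edge adj| - #|B|).
  rewrite -[LHS]mulr1; congr (_ * _).
  rewrite -[LHS](resample_cst p [set: edge adj] 1 finset.set0) /resample powersetT.
  rewrite cardsT; apply: eq_big => [B|B _]; first by rewrite inE.
  by rewrite mulr1.
rewrite mulr_sumr; apply: ler_sum => B _.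
rewrite [leRHS]mulrC; apply: ler_wpM2l.
  by rewrite mulr_ge0 // exprn_ge0 // ?subr_ge0 ltW.
by rewrite ler_weXn2l ?card_components_le // ltW.
Qed.

(** Open edges cost [32 * p * m * L], closed ones [4 * p * m * L], and the partition function
    [n * ln q]. *)
Lemma ln_inv_rc_measure_le A : #|A|%:R <= 32 * p * m ->
  ln (mu A)^-1 <= 36 * (p * m * L) + n * ln q.
Proof.
move=> Asmall; have [L2 Lp _ Lp4] := ln_inv_min_bounds p_gt0 p_lt1.
rewrite -/L in L2 Lp Lp4.
have p1 : 0 < 1 - p by rewrite subr_gt0.
have wA := rc_weight_gt0 p_gt0 p_lt1 q_gt1 A.
have Z0 := rc_partition_gt0 adj p_gt0 p_lt1 q_gt1.
have lnq : 0 <= ln q by rewrite ln_ge0 // ltW.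
rewrite /mu /rc_measure invf_div ln_div ?posrE //.
have lnZ : ln (\sum_(B : config adj) rc_weight p q B) <= n * ln q.
  rewrite mulr_natl -lnXn // ler_ln ?posrE ?exprn_gt0 //.
  exact: rc_partition_le.
have Am : (#|A| <= #|edge adj|)%N by exact: max_card.
have -> : ln (rc_weight p q A) = #|A|%:R * ln p +
    (#|edge adj| - #|A|)%:R * ln (1 - p) + #|components A|%:R * ln q.
  rewrite /rc_weight !lnM ?posrE ?mulr_gt0 ?exprn_gt0 //.
  by rewrite !lnXn // !mulr_natl.
have c0 : 0 <= #|components A|%:R * ln q by rewrite mulr_ge0 ?ler0n.
have ln1p : 0 <= - ln (1 - p).
  by rewrite oppr_ge0 ln_le0 // lerBlDr lerDl ltW.
have H1 : #|A|%:R * - ln p <= 32 * p * m * L.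
  apply: (@le_trans _ _ (#|A|%:R * L)); first by rewrite ler_wpM2l ?ler0n.
  by rewrite ler_wpM2r // (le_trans _ L2) // invr_ge0.
have H2 : (#|edge adj| - #|A|)%:R * - ln (1 - p) <= m * (4 * p * L).
  by rewrite ler_pM ?ler0n // ler_nat leq_subr.
lra.
Qed.

Hypothesis m_gt0 : 0 < m.

Let c_mix := 36 * (p * m * L) + n * ln q + 15.

(** Burn-in for [s] steps, relaxation for [t]: dense states after the burn-in have probability at
    most [8^-1], and a sparse one ends within [8^-1] of [mu]. *)
Lemma glauber_mixed T s t A : (0 < T)%N ->
  (forall B, tv_dist (kpow (cm_step adj p q) T B) mu <= 4^-1) ->
  m * (ln m + 15) <= s%:R ->
  2 * q * m * T%:R * c_mix <= t%:R ->
  tv_dist (kpow (glauber_step adj p q) (s + t) A) mu <= 4^-1.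
Proof.
move=> T0 mix hs ht.
have T1 : 1 <= T%:R :> R by rewrite ler1n.
have m1 : 1 <= m by rewrite /m ler1n -(ltr0n R).
have HM : stochastic (glauber_step adj p q) by exact: glauber_step_stochastic.
have Hsa : self_adjoint mu (glauber_step adj p q).
  exact: glauber_step_self_adjoint.
have mu0 B : 0 < mu B by exact: rc_measure_gt0.
have mu1 := sum_rc_measure adj p_gt0 p_lt1 q_gt1.
have [K0 K1] := kpow_stochastic s HM.
have burn : m * (1 - m^-1) ^+ s <= 16^-1.
  apply: geometric_decay => //; first by rewrite invf_le1.
  by rewrite ler_pdivlMr // mulrC.
pose gamma := (2 * q * m * T%:R)^-1.
have d1 : 1 <= 2 * q * m * T%:R.
  have q1 := ltW q_gt1.
  have : 1 * 1 <= q * m by rewrite ler_pM.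
  have : 1 * 1 <= (q * m) * T%:R.
    rewrite ler_pM // -[leLHS]mulr1 ler_pM //.
  lra.
have gamma0 : 0 < gamma by rewrite invr_gt0 (lt_le_trans _ d1).
have gamma1 : gamma <= 1 by rewrite invf_le1 // (lt_le_trans _ d1).
have sparse (B : config adj) : #|B|%:R <= 32 * p * m ->
    tv_dist (kpow (glauber_step adj p q) t B) mu <= 8^-1.
  move=> Bsmall.
  have contr f := glauber_step_spectral_gap p_gt0 p_lt1 q_gt1 m_gt0 (f := f) T0 mix.
  have := contraction_tv_dist mu0 mu1 t B HM Hsa _ contr.
  rewrite -/gamma subr_ge0 => /(_ gamma1) tv2.
  have : (mu B)^-1 * (1 - gamma) ^+ t <= 16^-1.
    apply: geometric_decay; rewrite ?invr_gt0 //.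
    rewrite /gamma ler_pdivlMr ?(lt_le_trans _ d1) // mulrC.
    apply: le_trans ht; rewrite ler_wpM2l ?(le_trans _ d1) // lerD2r.
    exact: ln_inv_rc_measure_le.
  rewrite mulrC => /(le_trans tv2).
  have tv0 : 0 <= tv_dist (kpow (glauber_step adj p q) t B) mu.
    by rewrite mulr_ge0 ?invr_ge0 // sumr_ge0.
  nra.
apply: le_trans (tv_dist_kpow_convex mu s t A HM) _.
apply: (@le_trans _ _ (\sum_B kpow (glauber_step adj p q) s A B *
    ((32 * p * m < #|B|%:R)%R%:R + 8^-1))).
  apply: ler_sum => B _; apply: ler_wpM2l => //.
  case: ltP => [_|/sparse]; last by rewrite add0r.
  by apply: (le_trans (tv_dist_le1 mu0 mu1 t B HM)); rewrite mulr1n lerDl invr_ge0.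
under eq_bigr do rewrite mulrDr.
rewrite big_split /= -mulr_suml K1.
have := glauber_sparse_whp p_gt0 p_lt1 q_gt1 m_gt0 A burn; rewrite -/m; lra.
Qed.

End Comparison.

(** The distances of two distinct point masses to [mu] add up to at least 1. This makes the
    Chayes-Machta mixing time positive. *)
Lemma tv_dist_kpow0_neq (R : realType) (S : finType) (M : S -> S -> R)
    (mu : S -> R) (x y : S) : x != y ->
  tv_dist (kpow M 0 x) mu <= 4^-1 -> tv_dist (kpow M 0 y) mu <= 4^-1 -> False.
Proof.
have low (z w : S) : z != w ->
    2^-1 * ((1 - mu z) + mu w) <= tv_dist (kpow M 0 z) mu.
  move=> zw; rewrite ler_wpM2l ?invr_ge0 //.
  rewrite (bigD1 z) //= (bigD1 w) /=; last by rewrite eq_sym.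
  rewrite eqxx (negPf zw) sub0r normrN lerD ?ler_norm //.
  by rewrite (le_trans (ler_norm _)) // lerDl sumr_ge0.
move=> xy; have := low _ _ xy; rewrite eq_sym in xy; have := low _ _ xy.
lra.
Qed.

(** Every lower-order term is absorbed into [a] or [b], the two terms of the bound. The burn-in and
    both roundings cost [18 * a]; the relaxation gives [144 + 30 = 174] and [4 * lq]. *)
Lemma comparison_arith (R : realType) (q p n m L lq lnn lnm T r s t : R) :
  1 < q -> 0 < p -> 2 <= n -> 1 <= m -> 2^-1 <= L -> 0 <= lq -> 2^-1 <= lnn ->
  lnm <= 2 * lnn -> 1 <= T -> T <= r ->
  s <= m * (lnm + 15) + 1 ->
  t <= 2 * q * m * T * (36 * (p * m * L) + n * lq + 15) + 1 ->
  s + t <= (18 + q * (174 + 4 * lq)) * (m * n * lnn + p * m ^+ 2 * lnn * L) * r.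
Proof.
move=> q1 p0 n2 m1 L2 lq0 lnn2 lnm2 T1 Tr hs ht.
pose a := m * n * lnn; pose b := p * m ^+ 2 * lnn * L.
have [q0 m0 n0 L0 T0] : [/\ 0 < q, 0 < m, 0 < n, 0 < L & 0 < T] by split; lra.
have lnn0 : 0 < lnn by lra.
have mn0 : 0 < m * n by rewrite mulr_gt0.
have b0 : 0 < b by rewrite !mulr_gt0 ?exprn_gt0.
have mn_a : m * n <= 2 * a.
  have : (m * n) * 2^-1 <= (m * n) * lnn by rewrite ler_wpM2l // ltW.
  rewrite /a; lra.
have m_a : m <= a.
  have : m * 2 <= m * n by rewrite ler_wpM2l // ltW.
  lra.
have lnm_a : m * lnm <= a.
  have : m * lnm <= m * (2 * lnn) by rewrite ler_wpM2l // ltW.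
  have : (m * lnn) * 2 <= (m * lnn) * n by rewrite ler_wpM2l // ltW // mulr_gt0.
  rewrite /a; lra.
have pmL_b : p * m ^+ 2 * L <= 2 * b.
  have : (p * m ^+ 2 * L) * 2^-1 <= (p * m ^+ 2 * L) * lnn.
    by rewrite ler_wpM2l // ltW // !mulr_gt0 ?exprn_gt0.
  rewrite /b; lra.
have mnlq : (m * n) * lq <= 2 * a * lq by rewrite ler_wpM2r.
have ht' : t <= 2 * q * T * (72 * b + 2 * a * lq + 15 * a) + a.
  apply: (le_trans ht); apply: lerD; last by lra.
  have -> : 2 * q * m * T * (36 * (p * m * L) + n * lq + 15) =
    2 * q * T * (36 * (p * m ^+ 2 * L) + (m * n) * lq + 15 * m) by ring.
  apply: ler_wpM2l; first by rewrite ltW // !mulr_gt0.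
  lra.
have a0 : 0 < a by lra.
have qa : 0 <= q * a by rewrite mulr_ge0 // ltW.
have qb : 0 <= q * b by rewrite mulr_ge0 // ltW.
have qalq : 0 <= q * a * lq by rewrite mulr_ge0.
have qblq : 0 <= q * b * lq by rewrite mulr_ge0.
have K0 : 0 <= 18 * a + q * (144 * b + 4 * a * lq + 30 * a).
  lra.
apply: (@le_trans _ _ (T * (18 * a + q * (144 * b + 4 * a * lq + 30 * a)))).
  have : 1 * (18 * a) <= T * (18 * a) by rewrite ler_wpM2r //; lra.
  lra.
rewrite -/a -/b [leRHS]mulrC; apply: ler_pM => //; first exact: ltW.
have -> : (18 + q * (174 + 4 * lq)) * (a + b) =
  18 * a + q * (144 * b + 4 * a * lq + 30 * a) +
  (q * (144 * a) + (18 * b + q * (30 * b) + 4 * (q * lq * b))) by ring.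
lra.
Qed.

(** * Edge and vertex counts, and the final comparison *)

Section Graph.
Context {V : finType} (adj : rel V).

Lemma card_edge : #|edge adj| = #|edge_set adj|.
Proof. by rewrite card_sig; apply: eq_card. Qed.

Lemma card_edge_le : (#|edge adj| <= #|V| ^ 2)%N.
Proof.
rewrite card_edge (leq_trans (leq_imset_card _ _)) //.
by rewrite (leq_trans (max_card _)) // card_prod mulnn.
Qed.

Lemma card_vertex_ge2 : irreflexive adj -> (0 < #|edge adj|)%N -> (1 < #|V|)%N.
Proof.
move=> irr; rewrite card_edge => /card_gt0P[f /imsetP[[u v]]].
rewrite inE /= => auv _.
have uv : u != v by apply: contraTneq auv => ->; rewrite irr.
have := max_card (mem [set u; v]); by rewrite cards2 uv.
Qed.

End Graph.

Theorem theorem6p1 (R : realType) (q : R) (hq : 1 < q) :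
  exists C : R, 0 < C /\
    forall (V : finType) (adj : rel V) (p : R),
      symmetric adj -> irreflexive adj -> 0 < p -> p < 1 ->
      let n : R := #|V|%:R in
      let m : R := #|edge_set adj|%:R in
      (mixing_time (glauber_step adj p q) (rc_measure adj p q)
       <= (C * (m * n * ln n
                + p * m ^+ 2 * ln n * ln (1 / Num.min p (1 - p))))%:E
          * mixing_time (cm_step adj p q) (rc_measure adj p q))%E.
Proof.
have lq0 : 0 <= ln q by rewrite ln_ge0 // ltW.
have q0 : 0 < q by rewrite (lt_trans _ hq).
have C0 : 0 < 18 + q * (174 + 4 * ln q).
  have : 0 <= q * ln q by rewrite mulr_ge0 // ltW.
  lra.
exists (18 + q * (174 + 4 * ln q)); split; first exact: C0.
move=> V adj p _ irr p0 p1.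
rewrite -card_edge /=; set n : R := #|V|%:R; set m : R := #|edge adj|%:R.
set mu := rc_measure adj p q.
(* Without edges the coefficient is 0, so the right-hand side is 0 even for an infinite mixing time;
   the only configuration is mixed at time 0. *)
have [m0|m0] := posnP #|edge adj|.
  have -> : m = 0 by rewrite /m m0.
  rewrite !mul0r expr0n mulr0 !mul0r addr0 mulr0 mul0e.
  apply: bigmax_le => // A _; apply: ereal_inf_lbound; exists 0%N => //=.
  have sing (B : config adj) : B = A.
    by apply/setP => e; have := fintype0 e m0.
  rewrite /tv_dist big1 ?mulr0 ?invr_ge0 // => B _ /=.
  rewrite (sing B) eqxx -(sum_rc_measure adj p0 p1 hq) (bigD1 A) //=.
  rewrite big1 ?addr0 ?subrr ?normr0 //.
  by move=> D; rewrite (sing D) eqxx.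
have mR : 0 < m by rewrite ltr0n.
have n2 : (2 : R) <= n by rewrite ler_nat (card_vertex_ge2 irr m0).
have m1 : 1 <= m by rewrite ler1n.
have n0 : 0 < n by lra.
have lnn : 2^-1 <= ln n.
  have : ln n^-1 <= n^-1 - 1 by apply: ln_le_sub1; rewrite invr_gt0.
  have : n^-1 <= 2^-1 by rewrite lef_pV2 ?posrE.
  rewrite lnV ?posrE //; lra.
have lnm : ln m <= 2 * ln n.
  rewrite mulr_natl -lnXn // ler_ln ?posrE ?exprn_gt0 //.
  by rewrite -natrX ler_nat card_edge_le.
have [L2 _ _ _] := ln_inv_min_bounds p0 p1.
set L := ln (1 / _) in L2 *.
have coef0 : 0 < (18 + q * (174 + 4 * ln q)) *
    (m * n * ln n + p * m ^+ 2 * ln n * L).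
  have [lnn0 L0] : 0 < ln n /\ 0 < L by split; lra.
  by rewrite mulr_gt0 // addr_gt0 // !mulr_gt0 ?exprn_gt0.
set cm := mixing_time (cm_step adj p q) mu.
have cm0 : (0 <= cm)%E by apply: bigmax_ge_id.
have cmA A : (mixing_time_from (cm_step adj p q) mu A <= cm)%E.
  exact: le_bigmax.
(* If the Chayes-Machta mixing time is infinite, the positive coefficient makes the bound
   infinite. *)
case: cm cm0 cmA => [r|_ _|//]; last by rewrite gt0_muley ?lte_fin ?leey.
rewrite lee_fin => r0 cmA.
(* Each start has an integer mixing time at most [r], hence at most the floor of [r]. *)
pose T := Num.truncn r.
have mix A : tv_dist (kpow (cm_step adj p q) T A) mu <= 4^-1.
  have [[k kmix kE]|inf] := mixing_time_fromP mu (cm_step adj p q) A; last first.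
    by have := cmA A; rewrite inf.
  have kT : (k <= T)%N.
    by rewrite truncn_ge_nat //; have := cmA A; rewrite kE lee_fin.
  rewrite -(subnKC kT) (le_trans _ kmix) // tv_dist_kpowD //.
    exact: cm_step_stochastic.
  exact: cm_step_self_adjoint.
have T0 : (0 < T)%N.
  rewrite lt0n; apply/eqP => T0.
  (* An edge provides two distinct configurations, which cannot both be mixed at time 0. *)
  have /card_gt0P[e _] := m0.
  have ne : (finset.set0 : config adj) != [set e].
    by apply/eqP => /setP /(_ e); rewrite !inE eqxx.
  by apply: (@tv_dist_kpow0_neq _ _ (cm_step adj p q) mu _ _ ne);
    have := mix; rewrite T0.
have T1 : 1 <= T%:R :> R by rewrite ler1n.
have lnm0 : 0 <= ln m by rewrite ln_ge0.
have [s [hs hs']] : exists s : nat,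
    m * (ln m + 15) <= s%:R /\ s%:R <= m * (ln m + 15) + 1.
  by apply: nat_ceil; rewrite mulr_ge0 ?addr_ge0 // ltW.
have [t [ht ht']] : exists t : nat,
    2 * q * m * T%:R * (36 * (p * m * L) + n * ln q + 15) <= t%:R /\
    t%:R <= 2 * q * m * T%:R * (36 * (p * m * L) + n * ln q + 15) + 1.
  have L0 : 0 < L by lra.
  have ? : 0 < p * m * L by rewrite !mulr_gt0.
  have ? : 0 <= n * ln q by rewrite mulr_ge0 // ltW.
  apply: nat_ceil; apply: mulr_ge0; last lra.
  by rewrite ltW // !mulr_gt0 // ltr0n.
rewrite -EFinM; apply: bigmax_le; first by rewrite lee_fin mulr_ge0 // ltW.
move=> A _.
apply: (@le_trans _ _ ((s + t)%N%:R)%:E).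
  apply: ereal_inf_lbound; exists (s + t)%N => //=.
  exact: (glauber_mixed p0 p1 hq mR A T0 mix hs ht).
rewrite lee_fin natrD.
apply: (@comparison_arith R q p n m L (ln q) (ln n) (ln m) T%:R) => //.
by rewrite truncn_le.
Qed.
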